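(* Let $p,q>0$, and let $X_p\sim N_p(0,1)$ and $X_q\sim N_q(0,1)$. Then $$X_p\preceq_{\mathrm{sc}} X_q\quad\Longleftrightarrow\quad p\le q.$$ Equivalently, there exists a strictly positive random variable $V$, independent of $X_q$, such that $X_p\stackrel{d}{=}VX_q$ if and only if $p\le q$. When such $V$ exists, its law is unique. More precisely: (1) If $p=q$, one may take $V=1$. (2) If $p<q$, put $a=1/p$, $b=1/q$, $\alpha=b/a=p/q$, let $S_\alpha$ be positive $\alpha$-stable, put $W_0=S_\alpha^{-b}$, let $W$ be the $W_0$-size-biased version of $W_0$, chosen independent of $X_q$, and define $V=2^{a-b}W$. Then $V>0$ almost surely, $V$ is independent of $X_q$, and $VX_q\stackrel{d}{=}X_p$. (3) If $p>q$, no such strictly positive independent factor $V$ exists.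
   Context: For $r>0$, $X_r\sim N_r(0,1)$ means that $X_r$ is a real random variable with density $$f_r(x)=\frac{r}{2^{1+1/r}\Gamma(1/r)}\exp\left(-\frac{|x|^r}{2}\right),\qquad x\in\mathbb{R}.$$ Positive scale-mixture relation: for probability laws $\mu,\nu$ on $\mathbb{R}$, write $\mu\preceq_{\mathrm{sc}}\nu$ if there exist (on some probability space) $Z\sim\nu$ and a random variable $V$ with $V>0$ almost surely, independent of $Z$, such that $VZ\sim\mu$. For random variables $Y,Z$, write $Y\preceq_{\mathrm{sc}}Z$ when the law of $Y$ is $\preceq_{\mathrm{sc}}$ the law of $Z$. The notation $\stackrel{d}{=}$ means equality in distribution. Positive $\alpha$-stable: for $0<\alpha<1$, $S_\alpha$ is the positive random variable with Laplace transform $\mathbb{E}e^{-uS_\alpha}=e^{-u^\alpha}$ for all $u\ge0$. Size-biasing: if $Y\ge0$ with $0<\mathbb{E}Y<\infty$, the $Y$-size-biased version $Y^*$ of $Y$ is a positive random variable with law $\mathbb{P}(Y^*\in A)=\mathbb{E}[Y\mathbf{1}_{\{Y\in A\}}]/\mathbb{E}Y$ for Borel sets $A\subseteq[0,\infty)$. (The variable $W_0$ above satisfies $0<\mathbb{E}W_0<\infty$.) *)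

(* Defs.v *)
From HB Require Import structures.
From mathcomp Require Export all_boot all_order all_algebra.
From mathcomp Require Export all_classical all_reals all_analysis.
Export Order.TTheory GRing.Theory Num.Theory.
Export numFieldNormedType.Exports.

Set Implicit Arguments.
Unset Strict Implicit.
Unset Printing Implicit Defensive.

Global Open Scope classical_set_scope.
Global Open Scope ring_scope.

Definition Gamma (R : realType) (s : R) : R :=
  Rintegral (@lebesgue_measure R) `]0, +oo[
    (fun t : R => t `^ (s - 1) * expR (- t)).

Definition gen_normal_pdf (R : realType) (r x : R) : R :=
  r / (2 `^ (1 + r^-1) * Gamma r^-1) * expR (- (`|x| `^ r / 2)).

(* Two laws are compared on Borel sets only: [pushforward] also takes values
   on non-measurable sets, and these carry no information. *)
Definition eq_law (R : realType) (mu nu : set R -> \bar R) : Prop :=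
  forall A : set R, measurable A -> mu A = nu A.

(* The law of X is N_r(0,1). *)
Definition gen_normal (R : realType) (r : R) (d : measure_display)
    (T : measurableType d) (P : probability T R) (X : T -> R) : Prop :=
  eq_law (pushforward P X)
    (fun A => \int[@lebesgue_measure R]_(x in A) (gen_normal_pdf r x)%:E)%E.

Definition independent_RV (R : realType) (d : measure_display)
    (T : measurableType d) (P : probability T R) (X Y : T -> R) : Prop :=
  forall A B : set R, measurable A -> measurable B ->
    P (X @^-1` A `&` Y @^-1` B) = (P (X @^-1` A) * P (Y @^-1` B))%E.

(* V is a strictly positive factor, independent of Z, such that V Z ~ mu. *)
Definition scale_factor (R : realType) (d : measure_display)
    (T : measurableType d) (P : probability T R) (V Z : T -> R)
    (mu : set R -> \bar R) : Prop :=
  [/\ {ae P, forall w, 0 < V w},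
      independent_RV P V Z &
      eq_law (pushforward P (fun w => V w * Z w)) mu].

Definition sc_le (R : realType) (mu nu : set R -> \bar R) : Prop :=
  exists (d : measure_display) (T : measurableType d) (P : probability T R)
    (Z V : {RV P >-> R}),
    eq_law (distribution P Z) nu /\ scale_factor P V Z mu.

Definition positive_stable (R : realType) (alpha : R) (d : measure_display)
    (T : measurableType d) (P : probability T R) (S : T -> R) : Prop :=
  [/\ 0 < alpha < 1,
      {ae P, forall w, 0 < S w} &
      forall u : R, 0 <= u ->
        'E_P[fun w => expR (- (u * S w))]%E = (expR (- (u `^ alpha)))%:E].

(* Ys (on the space of P') is a Y-size-biased version of Y (on the space
   of P).  The almost sure positivity of Ys is not required, since the
   formula implies it (take A = [0,+oo[ and A = {0}). *)
Definition size_biased (R : realType)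
    (d : measure_display) (T : measurableType d) (P : probability T R)
    (Y : T -> R)
    (d' : measure_display) (T' : measurableType d') (P' : probability T' R)
    (Ys : T' -> R) : Prop :=
  [/\ {ae P, forall w, 0 <= Y w},
      (0 < 'E_P[Y] < +oo)%E &
      forall A : set R, measurable A -> A `<=` `[0, +oo[ ->
        P' (Ys @^-1` A) =
        ('E_P[fun w => (Y w * \1_A (Y w))%R] / 'E_P[Y])%E].

(* Main.v *)
(* The product V X with X of density f and V > 0 independent of X has density
   E[f(y / V) / V].  For f proportional to exp(-|x|^q / 2), this is the Laplace
   transform at |y|^q / 2 of Y = V^-q under the weight 1 / V.  So V X_q ~ X_p
   means that this transform is proportional to u |-> exp(-(2 u)^(p/q) / 2).
   Size-biasing S^(-1/q), with S positive (p/q)-stable, cancels the weight and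
   gives such a V when p < q.  Injectivity of the Laplace transform gives
   uniqueness.  A Laplace transform of a nonzero measure decays at most
   exponentially, which rules out p > q.

   Both uniqueness and the existence of S use that (1 - exp(-v_n y))^N_n tends
   to the indicator of a ray for suitable v_n and N_n.  The function exp(-u^a)
   is positive on the nonnegative exponential sums, as u^a is an integral of
   functions 1 - exp(-u t).  The distribution function of S at x is the infimum
   of the corresponding functional over the exponential sums that majorize the
   indicator of [0, x]. *)
From HB Require Import structures.
Require Import Defs.
From mathcomp Require Import measurable_realfun ring lra.

Set Implicit Arguments.
Unset Strict Implicit.
Unset Printing Implicit Defensive.

(** * Integrals against weighted and rescaled measures *)

(** Nothing is computed with [Gamma]. The existence of a variable of law N_r forces its density to
    have mass 1, which gives the integral of exp(- |x|^r / 2); comparing these masses for p and q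
    gives the moment E S^(-1/q).

    Equality of laws gives equality of densities only almost everywhere. As E[f(y / V) / V]
    decreases in y > 0, the identity extends to every y > 0, and so to the Laplace transforms at
    every u > 0. Since u = 0 is not reached, the measures compared are first multiplied by exp(- y),
    which makes them finite.

    The stable variable comes from a form of Bernstein's theorem in which positivity on exponential
    sums replaces complete monotonicity. This positivity is stable under products, nonnegative
    combinations and pointwise limits, so it passes from compound Poisson laws, whose jump measures
    truncate t^(-a-1) dt, to the stable law. The functional is defined on exponential sums only and
    cannot be evaluated on indicators; a layer-cake sum therefore links the infimum over majorants
    back to the transform. *)

Section weighted_integral.
Local Open Scope ereal_scope.
Context d d' (T : measurableType d) (U : measurableType d') (R : realType).
Variables (mu : {measure set T -> \bar R}) (w : T -> R) (Y : T -> U).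
Variable nu : {measure set U -> \bar R}.
Hypotheses (mw : measurable_fun [set: T] w) (w_ge0 : forall x, (0 <= w x)%R).
Hypothesis mY : measurable_fun setT Y.
Hypothesis nuE : forall A : set U, measurable A ->
  nu A = \int[mu]_x ((w x)%:E * (\1_A (Y x))%:E).

Import HBNNSimple.

(** [nu] is the image under [Y] of the measure with density [w]. A constant [w] gives changes of
    variable, the identity for [Y] gives densities, and the general case serves size-biasing and
    Laplace transforms. The hypothesis is the case of indicators; simple functions and monotone
    convergence do the rest. *)
Lemma ge0_integral_weighted (g : U -> \bar R) :
  measurable_fun setT g -> (forall y, 0 <= g y) ->
  \int[nu]_y g y = \int[mu]_x ((w x)%:E * g (Y x)).
Proof.
move=> mg g0.
pose g_ := nnsfun_approx measurableT mg.
have mgY n : measurable_fun setT (fun x => (g_ n (Y x))%:E).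
  exact/measurable_EFinP/measurableT_comp.
have gcvg y : EFin \o g_^~ y @ \oo --> g y by exact: cvg_nnsfun_approx.
have nd y : nondecreasing_seq (fun n => (g_ n y)%:E).
  by move=> a b ab; rewrite lee_fin; exact/lefP/nd_nnsfun_approx.
have ig0 n (r : R) (y : U) : (0 <= r * \1_(g_ n @^-1` [set r]) y)%R.
  by rewrite -lee_fin EFinM nnfun_muleindic_ge0.
have simple n : \int[nu]_y (g_ n y)%:E = \int[mu]_x ((w x)%:E * (g_ n (Y x))%:E).
  transitivity (\int[nu]_y (\sum_(r \in range (g_ n))
      (r * \1_(g_ n @^-1` [set r]) y)%:E)).
    by apply: eq_integral => y _; rewrite fsumEFin// -fimfunE.
  rewrite ge0_integral_fsum//; last 2 first.
  - by move=> r; exact/measurable_EFinP/measurable_funM.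
  - by move=> r x _; rewrite nnfun_muleindic_ge0.
  transitivity (\sum_(r \in range (g_ n))
      \int[mu]_x ((w x)%:E * (r * \1_(g_ n @^-1` [set r]) (Y x))%:E)).
    apply: eq_fsbigr => r rg.
    rewrite integralZl_indic_nnsfun// integral_indic// setIT nuE//.
    have r0 : (0 <= r)%R by move: rg; rewrite inE => -[y _ <-].
    rewrite -ge0_integralZl//.
    - by apply: eq_integral => x _; rewrite EFinM muleCA.
    - apply: emeasurable_funM; apply/measurable_EFinP => //.
      exact: measurableT_comp.
    - by move=> x _; rewrite mule_ge0 ?lee_fin.
  rewrite -ge0_integral_fsum//.
  - apply: eq_integral => x _.
    by rewrite -ge0_mule_fsumr ?fsumEFin -?fimfunE// => r; rewrite lee_fin.
  - move=> r; apply: emeasurable_funM; apply/measurable_EFinP => //.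
    by apply: measurable_funM => //; exact: measurableT_comp.
  - by move=> r x _; rewrite mule_ge0 ?lee_fin.
transitivity (limn (fun n => \int[nu]_y (g_ n y)%:E)).
  rewrite -monotone_convergence//.
  - by apply: eq_integral => y _; apply/esym/cvg_lim => //; exact: gcvg.
  - by move=> n; exact/measurable_EFinP.
  - by move=> n y _; rewrite lee_fin.
under eq_fun do rewrite simple.
rewrite -monotone_convergence//.
- apply: eq_integral => x _; apply/cvg_lim => //.
  apply: cvgeZl => //; exact: gcvg.
- by move=> n; apply: emeasurable_funM => //; exact/measurable_EFinP.
- by move=> n x _; rewrite mule_ge0 ?lee_fin.
- by move=> x _ a b ab; rewrite lee_wpmul2l ?lee_fin//; exact: nd.
Unshelve. all: by end_near.
Qed.

End weighted_integral.

Section lebesgue_affine.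
Context {R : realType}.
Local Notation mu := (@lebesgue_measure R).

Lemma lebesgue_measure_affine (v s : R) (A : set R) : 0 < v -> measurable A ->
  mu A = (v%:E * mu [set x | A (v * x + s)%R])%E.
Proof.
move=> v0 mA.
pose aff : measurableTypeR R -> measurableTypeR R := fun x => v * x + s.
have maff : measurable_fun setT aff.
  by apply: measurable_funD => //; exact: measurable_funM.
pose vn := NngNum (ltW v0).
pose m2 :=
  (mscale vn (pushforward mu aff) : {measure set _ -> \bar R}).
rewrite (_ : (v%:E * _)%E = m2 maff A)//.
apply: lebesgue_measure_unique => //= _ [[a b]] _ <-.
rewrite /m2 /= /mscale /= /pushforward.
have -> : aff @^-1` `]a, b] = `](a - s) / v, (b - s) / v]%classic.
  apply/seteqP; split => x /=; rewrite !in_itv/= /aff.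
    by rewrite ltr_pdivrMr// ler_pdivlMr// ltrBlDr lerBrDr mulrC.
  by rewrite ltr_pdivrMr// ler_pdivlMr// ltrBlDr lerBrDr mulrC.
rewrite !lebesgue_measure_itv/= !lte_fin.
rewrite ltr_pM2r ?invr_gt0// ltrD2r; case: ifPn => _; last by rewrite mule0.
by rewrite -!EFinD -EFinM; congr EFin; field; rewrite gt_eqF.
Qed.

Lemma ge0_integral_affine (v s : R) (f : R -> \bar R) : 0 < v ->
  measurable_fun [set: R] f -> (forall x, (0 <= f x)%E) ->
  (\int[mu]_x f x = v%:E * \int[mu]_x f (v * x + s)%R)%E.
Proof.
move=> v0 mf f0.
have maff : measurable_fun [set: measurableTypeR R]
    ((fun x => v * x + s) : measurableTypeR R -> R).
  by apply: measurable_funD => //; exact: measurable_funM.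
rewrite (@ge0_integral_weighted _ _ _ (measurableTypeR R) R mu (cst v)
  (fun x : measurableTypeR R => v * x + s))//=.
- rewrite ge0_integralZl//; last by rewrite lee_fin ltW.
  exact: (@measurableT_comp _ _ _ _ _ _ f).
- by move=> x; rewrite ltW.
- move=> A mA; rewrite ge0_integralZl//=.
  + rewrite (@lebesgue_measure_affine v s)//; congr (_ * _)%E.
    rewrite -(setIT [set x | _]) -integral_indic//.
    by rewrite -[X in measurable X]setTI; exact: maff.
  + apply/measurable_EFinP.
    by apply: (@measurableT_comp _ _ _ _ _ _ (\1_A : R -> R)).
  + by rewrite lee_fin ltW.
Qed.

Lemma ge0_integral_scale (v : R) (f : R -> \bar R) : 0 < v ->
  measurable_fun [set: R] f -> (forall x, (0 <= f x)%E) ->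
  (\int[mu]_x f x = v%:E * \int[mu]_x f (v * x)%R)%E.
Proof.
move=> v0 mf f0; rewrite (@ge0_integral_affine v 0)//.
by under eq_integral do rewrite addr0.
Qed.

End lebesgue_affine.

Lemma measurable_inv (R : realType) : measurable_fun [set: R] (@GRing.inv R).
Proof.
(* This reduces the inverse to real powers, whose measurability is known; at 0 both sides are 0. *)
rewrite (_ : GRing.inv = fun x : R => x * (`|x| `^ (-1)) ^+ 2).
  apply: measurable_funM => //; apply: measurable_funX.
  by apply: (measurableT_comp (measurable_powR _)).
apply/funext => x; rewrite powR_inv1// exprVn real_normK ?num_real//.
have [->|x0] := eqVneq x 0; first by rewrite invr0 mul0r.
by field.
Qed.

Section scale_law.
Context d (T : measurableType d) (R : realType) (P : probability T R).
Local Notation mu := (@lebesgue_measure R).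
Local Open Scope ereal_scope.

Lemma integral_indep (V X : {RV P >-> R}) (g : R * R -> \bar R) :
  independent_RV P V X -> measurable_fun [set: R * R] g -> (forall z, 0 <= g z) ->
  \int[P]_w g (V w, X w) =
  \int[distribution P V]_v \int[distribution P X]_x g (v, x).
Proof.
move=> ind mg g0.
have mVX : measurable_fun [set: T] (fun w => (V w, X w)).
  exact/measurable_fun_pair.
rewrite -[RHS](@fubini_tonelli1 _ _ _ _ _ (distribution P V) (distribution P X) g)//.
pose J := (pushforward P (fun w => (V w, X w)) :
  {measure set (R * R)%type -> \bar R}).
have -> : \int[distribution P V \x distribution P X]_z g z = \int[J mVX]_z g z.
  apply: eq_measure_integral => A mA _.
  apply: (@product_measure_unique _ _ _ _ _ (distribution P V)
    (distribution P X) (J mVX)) => [B C mB mC|//].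
  exact: (ind B C mB mC).
by rewrite /J ge0_integral_pushforward.
Qed.

Lemma ge0_integral_density (X : {RV P >-> R}) (f : R -> R) (g : R -> \bar R) :
  measurable_fun [set: R] f -> (forall x, (0 <= f x)%R) ->
  eq_law (pushforward P X) (fun A => \int[mu]_(x in A) (f x)%:E) ->
  measurable_fun [set: R] g -> (forall x, 0 <= g x) ->
  \int[distribution P X]_x g x = \int[mu]_x ((f x)%:E * g x).
Proof.
move=> mf f0 fX mg g0.
rewrite (@ge0_integral_weighted _ _ (measurableTypeR R) R R mu f idfun)//=.
  by move=> _ A mA; rewrite setTI.
move=> A mA; rewrite [LHS]fX//= integral_mkcond; apply: eq_integral => x _.
by rewrite epatch_indic.
Qed.

(* The absolute value keeps the density nonnegative on the null set where [V] is
   not positive. *)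
Lemma scale_product_law (V X : {RV P >-> R}) (f : R -> R) :
  {ae P, forall w, (0 < V w)%R} -> independent_RV P V X ->
  measurable_fun [set: R] f -> (forall x, (0 <= f x)%R) ->
  eq_law (pushforward P X) (fun A => \int[mu]_(x in A) (f x)%:E) ->
  eq_law (pushforward P (fun w => V w * X w)%R)
    (fun A => \int[mu]_(y in A) \int[P]_w (`|V w|^-1 * f (y / V w))%:E).
Proof.
move=> V0 ind mf f0 fX A mA.
pose h (z : R * R) : \bar R := (\1_A (z.1 * z.2)%R)%:E.
have mh : measurable_fun [set: R * R] h.
  apply/measurable_EFinP; apply: measurableT_comp => //.
  by apply: measurable_funM.
have h0 z : 0 <= h z by rewrite lee_fin.
transitivity (\int[P]_w h (V w, X w)).
  rewrite /pushforward -(setIT (_ @^-1` _)) -integral_indic//.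
  rewrite -[X in measurable X]setTI.
  by apply: measurable_funM.
rewrite integral_indep//.
under eq_integral => v _.
  rewrite (@ge0_integral_density X f (fun x => h (v, x)))//; last first.
    exact: measurableT_comp.
  over.
pose k (v y : R) := (`|v|^-1 * f (y / v))%R.
have mk : measurable_fun [set: R * R] (fun z : R * R => k z.1 z.2).
  apply: measurable_funM.
    apply: (measurableT_comp (@measurable_inv R)).
    exact: measurableT_comp.
  apply: measurableT_comp => //; apply: measurable_funM => //.
  exact: (measurableT_comp (@measurable_inv R)).
have k0 v y : (0 <= k v y)%R by rewrite mulr_ge0 ?invr_ge0.
transitivity (\int[distribution P V]_v
    \int[mu]_y ((k v y)%:E * (\1_A y)%:E)); last first.
  rewrite (@fubini_tonelli _ _ _ (measurableTypeR R) _ (distribution P V) mu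
    (fun z => (k z.1 z.2)%:E * (\1_A z.2)%:E))//=; last 2 first.
  - apply: emeasurable_funM; apply/measurable_EFinP; first exact: mk.
    by apply: (@measurableT_comp _ _ _ _ _ _ (\1_A : R -> R)).
  - by move=> z; rewrite mule_ge0 ?lee_fin.
  rewrite [RHS]integral_mkcond; apply: eq_integral => y _.
  rewrite epatch_indic ge0_integralZr//.
  - congr (_ * _); rewrite ge0_integral_distribution//=.
    + apply/measurable_EFinP; exact: (measurableT_comp mk (pair2_measurable _)).
    + by move=> v; rewrite lee_fin k0.
  - apply/measurable_EFinP; exact: (measurableT_comp mk (pair2_measurable _)).
  - by move=> v _; rewrite lee_fin k0.
have mk2 : measurable_fun [set: R * measurableTypeR R]
    (fun z => (k z.1 z.2)%:E * (\1_A z.2)%:E).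
  apply: emeasurable_funM; apply/measurable_EFinP; first exact: mk.
  by apply: (@measurableT_comp _ _ _ _ _ _ (\1_A : R -> R)).
have mk1 : measurable_fun [set: R * measurableTypeR R]
    (fun z => (f z.2)%:E * h (z.1, z.2)).
  apply: emeasurable_funM => //; first exact/measurable_EFinP/measurableT_comp.
(* The inner integrals correspond under y = v x, a substitution available only for v > 0; hence a
   comparison almost everywhere for the law of [V]. *)
apply: ge0_ae_eq_integral => //.
- apply: (@measurable_fun_fubini_tonelli_F _ _ R (measurableTypeR R) R mu _ mk1)
    => z.
  by rewrite mule_ge0 ?lee_fin.
- apply: (@measurable_fun_fubini_tonelli_F _ _ R (measurableTypeR R) R mu _ mk2)
    => z.
  by rewrite mule_ge0 ?lee_fin.
- by move=> v _; apply: integral_ge0 => x _; rewrite mule_ge0 ?lee_fin.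
- by move=> v _; apply: integral_ge0 => x _; rewrite mule_ge0 ?lee_fin.
have : {ae distribution P V, forall v : R, (0 < v)%R}.
  exists `]-oo, 0%R]%classic; split => //.
    rewrite /distribution /pushforward /=.
    case: V0 => N [mN N0 sN]; apply: (subset_measure0 _ mN) => //.
      by rewrite -[X in measurable X]setTI; exact: measurable_funPT.
    apply: subset_trans sN => w /=.
    by rewrite in_itv/= leNgt => /negP.
  by move=> v /=; rewrite in_itv/= leNgt => /negP.
apply: filterS => v v0 _.
rewrite [RHS](@ge0_integral_scale _ v)//.
- rewrite -ge0_integralZl//=.
  + apply: eq_integral => x _; rewrite /h /k /= gtr0_norm//.
    have -> : (v * x / v = x)%R by rewrite mulrAC mulfV ?gt_eqF// mul1r.
    by rewrite -!EFinM !mulrA mulfV ?gt_eqF// mul1r.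
  + have mvx : measurable_fun [set: measurableTypeR R]
        ((fun x => v * x)%R : measurableTypeR R -> R) by exact: measurable_funM.
    apply: emeasurable_funM; apply/measurable_EFinP.
      by apply: (measurableT_comp (measurableT_comp mk (pair1_measurable v)) mvx).
    by apply: (@measurableT_comp _ _ _ _ _ _ (\1_A : R -> R)).
  + by move=> x _; rewrite mule_ge0 ?lee_fin.
  + by rewrite lee_fin ltW.
- apply: emeasurable_funM; apply/measurable_EFinP => //.
  exact: (measurableT_comp mk (pair1_measurable _)).
- by move=> x; rewrite mule_ge0 ?lee_fin.
Qed.

End scale_law.

(** * The size-biased stable factor *)

Definition gen_normal_exp (R : realType) (r x : R) : R :=
  expR (- (`|x| `^ r / 2)).

Definition gen_normal_cst (R : realType) (r : R) : R :=
  r / (2 `^ (1 + r^-1) * Gamma r^-1).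

Section gen_normal_mass.
Variable R : realType.
Local Notation mu := (@lebesgue_measure R).

Lemma gen_normal_pdfE (r x : R) :
  gen_normal_pdf r x = gen_normal_cst r * gen_normal_exp r x.
Proof. by []. Qed.

Lemma measurable_gen_normal_exp (r : R) :
  measurable_fun [set: R] (gen_normal_exp r).
Proof.
apply: (measurableT_comp (@measurable_expR R)).
apply: measurableT_comp => //; apply: measurable_funM => //.
by apply: (measurableT_comp (measurable_powR r)).
Qed.

Lemma gen_normal_exp_ge0 (r x : R) : 0 <= gen_normal_exp r x.
Proof. exact: expR_ge0. Qed.

Lemma measurable_gen_normal_pdf (r : R) :
  measurable_fun [set: R] (gen_normal_pdf r).
Proof. apply: measurable_funM => //; exact: measurable_gen_normal_exp. Qed.

(** Strict positivity is not yet available: [Rintegral] sends an infinite integral to 0, and then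
    the constant would be 0 as well. *)
Lemma gen_normal_cst_ge0 (r : R) : 0 < r -> 0 <= gen_normal_cst r.
Proof.
move=> r0; apply: divr_ge0; first exact: ltW.
apply: mulr_ge0; first exact: powR_ge0.
rewrite /Gamma /Rintegral fine_ge0//; apply: integral_ge0 => x _.
by rewrite lee_fin mulr_ge0 ?powR_ge0 ?expR_ge0.
Qed.

Lemma gen_normal_pdf_ge0 (r x : R) : 0 < r -> 0 <= gen_normal_pdf r x.
Proof.
move=> r0; rewrite gen_normal_pdfE mulr_ge0 ?gen_normal_cst_ge0//.
exact: gen_normal_exp_ge0.
Qed.

(** The law of [X] has total mass 1. A zero constant would make this mass 0 and an infinite integral
    would make it infinite, so both factors are determined up to inversion. *)
Lemma gen_normal_mass d (T : measurableType d) (P : probability T R)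
    (X : T -> R) (r : R) : 0 < r -> gen_normal r P X ->
  0 < gen_normal_cst r /\
  (\int[mu]_x (gen_normal_exp r x)%:E = (gen_normal_cst r)^-1%:E)%E.
Proof.
move=> r0 /(_ setT measurableT).
rewrite /pushforward preimage_setT probability_setT.
under eq_integral do rewrite gen_normal_pdfE EFinM.
have mE : measurable_fun [set: measurableTypeR R]
  (fun x => (gen_normal_exp r x)%:E).
  apply/measurable_EFinP.
  exact: (measurable_gen_normal_exp r).
rewrite ge0_integralZl//; last 2 first.
- by move=> x _; rewrite lee_fin gen_normal_exp_ge0.
- by rewrite lee_fin gen_normal_cst_ge0.
have : (0 <= \int[mu]_x (gen_normal_exp r x)%:E)%E.
  by apply: integral_ge0 => x _; rewrite lee_fin gen_normal_exp_ge0.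
have := gen_normal_cst_ge0 r0; rewrite le_eqVlt => /predU1P[<- _|c0].
  by rewrite mul0e => /eqP; rewrite eqe oner_eq0.
case: (\int[mu]_x _)%E => [I _|_|//]; last first.
  by rewrite mulry gtr0_sg// mul1e.
move=> [cI]; split=> //; congr EFin.
by apply: (mulfI (lt0r_neq0 c0)); rewrite -cI mulfV// gt_eqF.
Qed.

End gen_normal_mass.

Section size_biased.
Local Open Scope ereal_scope.
Context (R : realType) d (T : measurableType d) (P : probability T R)
  d0 (T0 : measurableType d0) (P0 : probability T0 R).

Lemma ge0_integral_size_biased (Y : T0 -> R) (W : {RV P >-> R})
    (g : R -> \bar R) :
  measurable_fun [set: T0] Y -> (forall w, (0 <= Y w)%R) ->
  size_biased P0 Y P W ->
  measurable_fun [set: R] g -> (forall x, 0 <= g x) ->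
  \int[P]_w g (W w) =
  \int[P0]_w (((fine 'E_P0[Y])^-1 * Y w)%:E * g (Y w)).
Proof.
move=> mY Y0 [_ EY WE] mg g0.
have EYf : 'E_P0[Y] \is a fin_num.
  by rewrite ge0_fin_numE; case/andP: EY => // /ltW.
have EY0 : (0 < fine 'E_P0[Y])%R by rewrite fine_gt0.
set m := fine _ in EY0 *.
have EYE : 'E_P0[Y] = m%:E by rewrite fineK.
have lawW (A : set R) : measurable A -> A `<=` `[0%R, +oo[ ->
    distribution P W A = \int[P0]_w ((m^-1 * Y w)%:E * (\1_A (Y w))%:E).
  move=> mA A0; rewrite /distribution /pushforward WE// EYE inver gt_eqF//.
  rewrite unlock muleC -ge0_integralZl//; last 3 first.
  - apply/measurable_EFinP; apply: measurable_funM => //.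
    exact: measurableT_comp.
  - by move=> w _; rewrite lee_fin mulr_ge0.
  - by rewrite lee_fin invr_ge0 ltW.
  by apply: eq_integral => w _; rewrite -!EFinM mulrA.
rewrite -ge0_integral_distribution//.
apply: ge0_integral_weighted => //.
- exact: measurable_funM.
- by move=> w; rewrite mulr_ge0// invr_ge0 ltW.
move=> A mA.
(* [size_biased] prescribes the law on subsets of [0, +oo[ only. The half-line already has
   probability 1, so the negative part of any set is null. *)
have nn_full : distribution P W `[0%R, +oo[ = 1.
  rewrite lawW//.
  transitivity (\int[P0]_w ((m^-1)%:E * (Y w)%:E)).
    apply: eq_integral => w _; rewrite -!EFinM indicE mem_set ?mulr1//=.
    by rewrite in_itv/= Y0.
  rewrite ge0_integralZl//; last 3 first.
  - exact/measurable_EFinP.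
  - by move=> w _; rewrite lee_fin.
  - by rewrite lee_fin invr_ge0 ltW.
  have -> : \int[P0]_w (Y w)%:E = m%:E by rewrite -EYE unlock.
  by rewrite -EFinM mulVf// gt_eqF.
transitivity (distribution P W (A `&` `[0%R, +oo[)).
  rewrite (@measureDI _ _ _ (distribution P W) _ _ mA (measurable_itv `[0%R, +oo[)).
  rewrite [X in X + _ = _](_ : _ = 0) ?add0e//.
  apply: (@subset_measure0 _ _ _ (distribution P W) _ (~` `[0%R, +oo[)).
  - exact: measurableD.
  - exact: measurableC.
  - by move=> x [].
  - transitivity (1 - distribution P W `[0%R, +oo[); last first.
      by rewrite nn_full subee.
    exact: probability_setC.
rewrite lawW//; last exact: measurableI.
apply: eq_integral => w _; rewrite indicI /=.
have -> : \1_(`[0%R, +oo[ : set R) (Y w) = 1%R :> R.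
  by rewrite indicE mem_set//= in_itv/= Y0.
by rewrite mulr1.
Qed.

End size_biased.

Section stable_mixture.
Variables (R : realType) (p q : R).
Hypotheses (p0 : 0 < p) (q0 : 0 < q).
Local Notation mu := (@lebesgue_measure R).
Local Notation c := (2 `^ (p^-1 - q^-1)).
(** Chosen so that kappa^(p/q) = 1/2: the stable transform at kappa |y|^q is then exp(- |y|^p /
    2). *)
Local Notation kappa := (2 `^ (- (q / p))).

Let c0 : 0 < c. Proof. exact: powR_gt0. Qed.

(** For v = c s^(-1/q) it gives exp(- |y|^q kappa s) = exp(- |y / v|^q / 2), so that each
    exponential in the stable mixture is a rescaled N_q density up to a constant. *)
Lemma stable_scaleE (s : R) : 0 < s ->
  (c * s `^ (- q^-1)) `^ q * (kappa * s) = 2^-1.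
Proof.
move=> s0; rewrite powRM ?powR_ge0// -!powRrM mulNr mulVf ?gt_eqF//.
rewrite powR_inv1 ?ltW// mulrACA mulVf ?gt_eqF// mulr1 -powRD; last first.
  by apply/implyP => _; rewrite pnatr_eq0.
have -> : (p^-1 - q^-1) * q + - (q / p) = -1.
  by field; rewrite !gt_eqF.
by rewrite powR_inv1.
Qed.

Lemma ge0_integral_exp_scale (s : R) : 0 < s ->
  (\int[mu]_y (expR (- (`|y| `^ q * kappa * s)))%:E =
   (c * s `^ (- q^-1))%:E * \int[mu]_y (gen_normal_exp q y)%:E)%E.
Proof.
move=> s0; have v0 : 0 < c * s `^ (- q^-1) by rewrite mulr_gt0 ?powR_gt0.
rewrite (ge0_integral_scale v0); last 2 first.
- apply/measurable_EFinP; apply: (measurableT_comp (@measurable_expR R)).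
  apply: measurableT_comp => //; do 2 apply: measurable_funM => //.
  by apply: (measurableT_comp (measurable_powR q)).
- by move=> x; rewrite lee_fin expR_ge0.
congr (_ * _)%E; apply: eq_integral => x _; congr (_%:E); congr expR.
congr (- _); rewrite normrM powRM// (gtr0_norm v0) -mulrA mulrAC.
by rewrite stable_scaleE// mulrC.
Qed.

Context d0 (T0 : measurableType d0) (P0 : probability T0 R) (S : {RV P0 >-> R}).
Hypothesis stableS : positive_stable (p / q) P0 S.
Local Notation W0 := (fun w : T0 => S w `^ (- q^-1)).

Let measurable_W0 : measurable_fun [set: T0] W0.
Proof. exact: (measurableT_comp (measurable_powR _)). Qed.

Lemma stable_mixture_exp (y : R) :
  (\int[P0]_w (expR (- (`|y| `^ q * kappa * S w)))%:E =
   (gen_normal_exp p y)%:E)%E.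
Proof.
have u0 : 0 <= `|y| `^ q * kappa by rewrite mulr_ge0 ?powR_ge0.
case: stableS => _ _ /(_ _ u0); rewrite unlock => ->.
congr (_%:E); congr expR; congr (- _).
rewrite powRM ?powR_ge0// -!powRrM; congr (_ `^ _ * _).
  by field; rewrite gt_eqF.
have -> : - (q / p) * (p / q) = -1 by field; rewrite !gt_eqF.
by rewrite powR_inv1.
Qed.

(** Integrating [stable_mixture_exp] over y with Tonelli gives the mass of exp(- |y|^p / 2) on one
    side, and E[c S^(-1/q)] times the mass of exp(- |y|^q / 2) on the other. Finiteness of the
    moment comes with its value. *)
Lemma stable_moment dp (Tp : measurableType dp) (Pp : probability Tp R)
    (Xp : Tp -> R) dq (Tq : measurableType dq) (Pq : probability Tq R)
    (Xq : Tq -> R) : gen_normal p Pp Xp -> gen_normal q Pq Xq ->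
  'E_P0[W0]%E = (gen_normal_cst q / (c * gen_normal_cst p))%:E.
Proof.
move=> /(gen_normal_mass p0)[Kp Ip] /(gen_normal_mass q0)[Kq Iq].
have : (\int[mu]_y (gen_normal_exp p y)%:E =
    (c / gen_normal_cst q)%:E * 'E_P0[W0])%E.
  under eq_integral do rewrite -stable_mixture_exp.
  pose k (z : T0 * measurableTypeR R) : \bar R :=
    (expR (- (`|z.2| `^ q * kappa * S z.1)))%:E.
  have mk : measurable_fun [set: T0 * measurableTypeR R] k.
    apply/measurable_EFinP; apply: (measurableT_comp (@measurable_expR R)).
    apply: measurableT_comp => //; apply: measurable_funM; last first.
      exact: measurableT_comp.
    apply: measurable_funM => //.
    apply: (measurableT_comp (measurable_powR q)).
    by apply: measurableT_comp.
  have k0 z : (0 <= k z)%E by rewrite lee_fin expR_ge0.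
  rewrite -(@fubini_tonelli _ _ T0 (measurableTypeR R) R P0 mu k)//.
  rewrite unlock -ge0_integralZl//; last 3 first.
  - exact/measurable_EFinP.
  - by move=> w _; rewrite lee_fin powR_ge0.
  - by rewrite lee_fin divr_ge0 ?ltW.
  apply: ge0_ae_eq_integral => //.
  - exact: (@measurable_fun_fubini_tonelli_F _ _ T0 (measurableTypeR R) R
      mu k mk k0).
  - by apply: emeasurable_funM => //; exact/measurable_EFinP.
  - by move=> w _; apply: integral_ge0 => y _; exact: k0.
  - by move=> w _; rewrite mule_ge0 ?lee_fin ?powR_ge0// divr_ge0 ?ltW.
  case: stableS => _ + _; apply: filterS => w Sw _.
  rewrite [LHS](ge0_integral_exp_scale Sw) Iq -!EFinM; congr EFin.
  by rewrite mulrAC.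
rewrite Ip => /esym; case: ('E_P0[W0])%E => [m||].
- move=> -[em]; congr EFin.
  apply: (mulfI (_ : c / gen_normal_cst q != 0)); first exact/lt0r_neq0/divr_gt0.
  have := lt0r_neq0 c0; have := lt0r_neq0 Kp; have := lt0r_neq0 Kq.
  rewrite em; move: (c) (gen_normal_cst p) (gen_normal_cst q) => ? ? ? *; field.
  by apply/and3P; split.
- by rewrite mulry gtr0_sg ?mul1e// divr_gt0.
- by rewrite mulrNy gtr0_sg ?mul1e// divr_gt0.
Qed.

Lemma size_biased_stable_scale_factor
    dp (Tp : measurableType dp) (Pp : probability Tp R) (Xp : Tp -> R)
    d (T : measurableType d) (P : probability T R) (X W : {RV P >-> R}) :
  gen_normal p Pp Xp -> gen_normal q P X -> size_biased P0 W0 P W ->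
  independent_RV P W X ->
  scale_factor P (fun w => c * W w) X (pushforward Pp Xp).
Proof.
move=> Xp_law X_law W_law ind.
have W0_ge0 w : 0 <= W0 w by exact: powR_ge0.
have W_gt0 : {ae P, forall w, 0 < W w}.
  (* The size-biased law weights each value of [W0] by that value, which is 0 as soon as it is
     nonpositive. *)
  exists (W @^-1` `]-oo, 0]); split.
  - by rewrite -[X in measurable X]setTI; exact: measurable_funPT.
  - have mI : measurable (W @^-1` `]-oo, 0]).
      by rewrite -[X in measurable X]setTI; exact: measurable_funPT.
    rewrite -[X in P X]setIT -integral_indic//.
    rewrite [LHS](_ : _ = \int[P]_w (\1_(`]-oo, 0]) (W w))%:E)%E//.
    rewrite (ge0_integral_size_biased (g := fun x => (\1_(`]-oo, 0]) x)%:E)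
      measurable_W0 W0_ge0 W_law)//; last exact/measurable_EFinP.
    apply: integral0_eq => w _; rewrite indicE.
    have [|] := boolP (W0 w \in _); last by rewrite mule0.
    rewrite inE/= in_itv/= => le0; have -> : W0 w = 0.
      by apply/eqP; rewrite eq_le le0 W0_ge0.
    by rewrite mulr0 mul0e.
  - by move=> w /=; rewrite in_itv/= leNgt => /negP.
have V_ind : independent_RV P (fun w => c * W w) X.
  move=> A B mA mB.
  have := ind ((fun v => c * v) @^-1` A) B; apply => //.
  rewrite -[X in measurable X]setTI.
  by apply: measurable_funM.
have V_gt0 : {ae P, forall w, 0 < c * W w}.
  by apply: filterS W_gt0 => w Ww; rewrite mulr_gt0.
split=> //.
have [Kp _] := gen_normal_mass p0 Xp_law.
have [Kq _] := gen_normal_mass q0 X_law.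
have mV : measurable_fun [set: T] (fun w => c * W w) by exact: measurable_funM.
pose VM := isMeasurableFun.Build _ _ _ _ _ mV.
pose V : {mfun T >-> R} := HB.pack (fun w => c * W w) VM.
move=> A mA.
rewrite [LHS](@scale_product_law _ _ _ _ V X (gen_normal_pdf q))//; last 2 first.
- exact: measurable_gen_normal_pdf.
- by move=> x; exact: gen_normal_pdf_ge0.
rewrite Xp_law//; apply: eq_integral => y _ /=.
pose g x := (`|c * x|^-1 * gen_normal_pdf q (y / (c * x)))%:E.
have mcx : measurable_fun [set: R] (fun x : R => c * x) by exact: measurable_funM.
have mg : measurable_fun [set: R] g.
  apply/measurable_EFinP; apply: measurable_funM.
    apply: (measurableT_comp (@measurable_inv R)).
    exact: measurableT_comp.
  apply: (measurableT_comp (measurable_gen_normal_pdf q)).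
  apply: measurable_funM => //.
  exact: (measurableT_comp (@measurable_inv R)).
have g0 x : (0 <= g x)%E.
  by rewrite lee_fin mulr_ge0 ?gen_normal_pdf_ge0// invr_ge0.
rewrite [LHS](ge0_integral_size_biased measurable_W0 W0_ge0 W_law mg g0).
rewrite (stable_moment Xp_law X_law)/=.
(* The weight W0 / E W0 meets the factor 1 / (c W0) of the density. What remains is the constant of
   N_q divided by c E W0, which is the constant of N_p by [stable_moment]. *)
transitivity (\int[P0]_w ((gen_normal_cst p)%:E *
  (expR (- (`|y| `^ q * kappa * S w)))%:E))%E.
  apply: ge0_ae_eq_integral => //.
  - apply: emeasurable_funM; last exact: measurableT_comp.
    by apply/measurable_EFinP; apply: measurable_funM.
  - apply: emeasurable_funM => //.
    apply/measurable_EFinP; apply: (measurableT_comp (@measurable_expR R)).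
    by apply: measurableT_comp => //; apply: measurable_funM.
  - move=> w _; rewrite mule_ge0// lee_fin mulr_ge0 ?powR_ge0// invr_ge0.
    apply: divr_ge0; first exact: ltW.
    exact: ltW (mulr_gt0 c0 Kp).
  - move=> w _; apply: mule_ge0; rewrite lee_fin; first exact: ltW Kp.
    exact: expR_ge0.
  case: stableS => _ + _; apply: filterS => w Sw _.
  have v0 : 0 < c * W0 w by rewrite mulr_gt0 ?powR_gt0.
  rewrite /g -!EFinM (gtr0_norm v0) gen_normal_pdfE; congr EFin.
  have -> : gen_normal_exp q (y / (c * W0 w)) =
      expR (- (`|y| `^ q * kappa * S w)).
    congr expR; congr (- _).
    have vs := stable_scaleE Sw; move: v0 vs.
    move: (c * _) => v v0 vs.
    rewrite normrM normfV (gtr0_norm v0) powRM ?invr_ge0// ?(ltW v0)//.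
    have vi : v^-1 `^ q * v `^ q = 1.
      by rewrite -powRM ?invr_ge0 ?(ltW v0)// mulVf ?gt_eqF// powR1.
    have -> : v^-1 `^ q = 2 * (kappa * S w).
      transitivity (2 * (v^-1 `^ q) * (v `^ q * (kappa * S w))).
        by rewrite vs; field.
      by rewrite -mulrA (mulrA (v^-1 `^ q)) vi mul1r.
    by field.
  set e := expR _; have r0 : S w `^ (- q^-1) != 0 by rewrite lt0r_neq0// powR_gt0.
  have := lt0r_neq0 c0; have := lt0r_neq0 Kp; have := lt0r_neq0 Kq.
  move: (c) (gen_normal_cst p) (gen_normal_cst q) (S w `^ _) r0 => c' a b r.
  by move=> r0 b0 a0 c'0; field; rewrite r0 c'0 a0 b0.
rewrite ge0_integralZl//.
- by rewrite stable_mixture_exp.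
- apply/measurable_EFinP; apply: (measurableT_comp (@measurable_expR R)).
  by apply: measurableT_comp => //; apply: measurable_funM.
- by rewrite lee_fin ltW.
Qed.

End stable_mixture.

(** * Probability spaces from densities, products and size-biasing *)

Section probability_constructions.
Local Open Scope ereal_scope.

Lemma density_measure (R : realType) d (T : measurableType d)
    (mu : {measure set T -> \bar R}) (f : T -> R) :
  measurable_fun [set: T] f -> (forall x, (0 <= f x)%R) ->
  exists nu : {measure set T -> \bar R}, forall A,
    nu A = \int[mu]_(x in A) (f x)%:E.
Proof.
move=> mf f0; pose nu (A : set T) := \int[mu]_(x in A) (f x)%:E.
have nu0 : nu set0 = 0 by rewrite /nu integral_set0.
have nu_ge0 A : 0 <= nu A by apply: integral_ge0 => x _; rewrite lee_fin.
have nu_add : semi_sigma_additive nu.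
  move=> F mF tF mUF; rewrite /nu; apply: cvg_toP.
    apply: ereal_nondecreasing_is_cvgn => m n mn.
    apply: lee_sum_nneg_natr => // k _ _; exact: nu_ge0.
  rewrite ge0_integral_bigcup//=.
  - exact/measurable_funTS/measurable_EFinP.
  - by move=> x _; rewrite lee_fin.
pose nuM : {measure set T -> \bar R} :=
  HB.pack nu (isMeasure.Build _ _ _ nu nu0 nu_ge0 nu_add).
by exists nuM.
Qed.

Lemma weighted_measure (R : realType) d (T : measurableType d)
    d' (U : measurableType d') (mu : {measure set T -> \bar R}) (w : T -> R)
    (Y : T -> U) :
  measurable_fun [set: T] w -> (forall x, (0 <= w x)%R) ->
  measurable_fun [set: T] Y ->
  exists nu : {measure set U -> \bar R}, forall A, measurable A ->
    nu A = \int[mu]_x ((w x)%:E * (\1_A (Y x))%:E).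
Proof.
move=> mw w0 mY; have [m mE] := density_measure mu mw w0.
pose nu := (pushforward m Y : {measure set U -> \bar R}).
exists (nu mY) => A mA; rewrite [LHS]mE integral_mkcond.
by apply: eq_integral => x _; rewrite epatch_indic.
Qed.

Lemma density_probability (R : realType) d (T : measurableType d)
    (mu : {measure set T -> \bar R}) (f : T -> R) :
  measurable_fun [set: T] f -> (forall x, (0 <= f x)%R) ->
  \int[mu]_x (f x)%:E = 1 ->
  exists Q : probability T R, forall A, Q A = \int[mu]_(x in A) (f x)%:E.
Proof.
move=> mf f0 f1; have [nu nuE] := density_measure mu mf f0.
have nuT : nu setT = 1 by rewrite nuE.
pose n A := nu A.
have n0 : n set0 = 0 by exact: measure0.
have n_ge0 A : 0 <= n A by exact: measure_ge0.
have n_add : semi_sigma_additive n by exact: measure_semi_sigma_additive.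
pose M := isMeasure.Build _ _ _ n n0 n_ge0 n_add.
pose nM : {measure set T -> \bar R} := HB.pack n M.
pose Q : probability T R := HB.pack n M
  (@Measure_isProbability.Build _ _ _ nM nuT).
by exists Q.
Qed.

Lemma product_probability (R : realType) d1 (T1 : measurableType d1)
    (P1 : probability T1 R) d2 (T2 : measurableType d2)
    (P2 : probability T2 R) :
  exists P : probability (T1 * T2)%type R, forall A B,
    measurable A -> measurable B -> P (A `*` B) = P1 A * P2 B.
Proof.
have P1T : (P1 \x P2) [set: T1 * T2] = 1.
  rewrite -setXTT product_measure1E//.
  by rewrite [X in X * _]probability_setT [X in _ * X]probability_setT mule1.
pose P : probability (T1 * T2)%type R := HB.pack (P1 \x P2)
  (@Measure_isProbability.Build _ _ _ (P1 \x P2) P1T).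
by exists P => A B mA mB; exact: product_measure1E.
Qed.

(** The function [Y] itself becomes size-biased when its probability is tilted by the density Y / E
    Y. The product with the space of [Xq] provides independence. *)
Lemma size_biased_exists (R : realType) d0 (T0 : measurableType d0)
    (P0 : probability T0 R) (Y : T0 -> R) dq (Tq : measurableType dq)
    (Pq : probability Tq R) (Xq : {RV Pq >-> R}) :
  measurable_fun [set: T0] Y -> (forall w, (0 <= Y w)%R) ->
  0 < 'E_P0[Y] < +oo ->
  exists (d : measure_display) (T : measurableType d) (P : probability T R)
    (X W : {RV P >-> R}),
    [/\ eq_law (pushforward P X) (pushforward Pq Xq), size_biased P0 Y P W &
        independent_RV P W X].
Proof.
move=> mY Y0 EY.
have EYf : 'E_P0[Y] \is a fin_num.
  by rewrite ge0_fin_numE; case/andP: EY => // /ltW.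
have EY0 : (0 < fine 'E_P0[Y])%R by rewrite fine_gt0.
set m := fine _ in EY0.
have EYE : 'E_P0[Y] = m%:E by rewrite fineK.
have scaled A : measurable A ->
    \int[P0]_(w in A) (m^-1 * Y w)%:E = (m^-1)%:E * \int[P0]_(w in A) (Y w)%:E.
  move=> mA; under eq_integral do rewrite EFinM.
  rewrite ge0_integralZl//.
  - exact/measurable_funTS/measurable_EFinP.
  - by move=> w _; rewrite lee_fin.
  - by rewrite lee_fin invr_ge0 ltW.
have [|||Q QE] := @density_probability R _ T0 P0 (fun w => m^-1 * Y w)%R.
- exact: measurable_funM.
- by move=> w; rewrite mulr_ge0// invr_ge0 ltW.
- rewrite scaled//; have -> : \int[P0]_w (Y w)%:E = m%:E by rewrite -EYE unlock.
  by rewrite -EFinM mulVf// gt_eqF.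
have [P PE] := product_probability Q Pq.
have mX : measurable_fun [set: T0 * Tq] (Xq \o snd) by exact: measurableT_comp.
have mW : measurable_fun [set: T0 * Tq] (Y \o fst) by exact: measurableT_comp.
pose X : {mfun (T0 * Tq)%type >-> R} :=
  HB.pack (Xq \o snd) (isMeasurableFun.Build _ _ _ _ _ mX).
pose W : {mfun (T0 * Tq)%type >-> R} :=
  HB.pack (Y \o fst) (isMeasurableFun.Build _ _ _ _ _ mW).
have mXq A : measurable A -> measurable (Xq @^-1` A).
  by move=> mA; rewrite -[X in measurable X]setTI; exact: measurable_funPT.
have mYA A : measurable A -> measurable (Y @^-1` A).
  by move=> mA; rewrite -[X in measurable X]setTI; exact: mY.
have PX A : measurable A -> P (X @^-1` A) = Pq (Xq @^-1` A).
  move=> mA; have := PE setT (Xq @^-1` A) measurableT (mXq _ mA).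
  by rewrite probability_setT mul1e setTX.
have PW A : measurable A -> P (W @^-1` A) = Q (Y @^-1` A).
  move=> mA; have := PE (Y @^-1` A) setT (mYA _ mA) measurableT.
  by rewrite probability_setT mule1 setXT.
exists _, (T0 * Tq)%type, P, X, W; split.
- by move=> A mA; exact: PX.
- split=> //; first exact: aeW.
  move=> A mA _; rewrite PW// QE scaled; last exact: mYA.
  rewrite EYE inver gt_eqF// muleC; congr (_ * _).
  rewrite unlock integral_mkcond; apply: eq_integral => w _.
  by rewrite epatch_indic EFinM /= !indicE.
- move=> A B mA mB; rewrite PX// PW// -PE; [|exact: mYA|exact: mXq].
  by congr (P _).
Qed.

End probability_constructions.

(** * Uniqueness of Laplace transforms *)

Section step_kernel.
Context {R : realType}.
Implicit Types x y c l : R.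

(** From exp(x / 2) >= x / 2 follows exp x >= (x / 2)^2; with x = (n + 1) l this gives an explicit
    rate 1 / (n + 1), suited to squeezing. *)
Lemma natr_expR_le l n : 0 < l ->
  n.+1%:R * expR (- (n.+1%:R * l)) <= 4 / l ^+ 2 * n.+1%:R^-1.
Proof.
move=> l0; set m : R := n.+1%:R; have m0 : 0 < m by rewrite ltr0n.
have ml0 : 0 < m * l / 2 by rewrite divr_gt0 ?mulr_gt0.
have h : m * l / 2 <= expR (m * l / 2).
  by apply: le_trans (expR_ge1Dx _); rewrite lerDr.
have h2 : (m * l / 2) ^+ 2 <= expR (m * l).
  have -> : expR (m * l) = expR (m * l / 2) ^+ 2.
    by rewrite expr2 -expRD; congr expR; field.
  by rewrite lerXn2r// nnegrE ?expR_ge0// ltW.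
rewrite expRN ler_pdivrMr ?expR_gt0//.
rewrite -(@ler_pM2l _ (l ^+ 2 * m / 4)) ?divr_gt0 ?mulr_gt0 ?exprn_gt0//.
have -> : l ^+ 2 * m / 4 * m = (m * l / 2) ^+ 2 by field.
have -> : l ^+ 2 * m / 4 * (4 / l ^+ 2 / m * expR (m * l)) = expR (m * l).
  by field; rewrite !gt_eqF.
exact: h2.
Qed.

Lemma bernoulli_ineq x n : 0 <= x <= 1 -> 1 - n%:R * x <= (1 - x) ^+ n.
Proof.
move=> /andP[x0 x1]; elim: n => [|n ih]; first by rewrite mul0r subr0 expr0.
rewrite exprS; apply: (@le_trans _ _ ((1 - x) * (1 - n%:R * x))).
  have : 0 <= n%:R * x * x by rewrite !mulr_ge0.
  by rewrite -natr1; move: (n%:R : R) => m; nra.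
by rewrite ler_wpM2l ?subr_ge0.
Qed.

(* With v_n = n ln 2 / c and N_n = n 2^n, the product N_n exp(- v_n y) tends to 0
   if c < y and is at least n if y <= c. *)
Lemma step_kernel c : 0 <= c -> exists (v : nat -> R) (N : nat -> nat),
  (forall n, 0 <= v n) /\ forall y, 0 <= y ->
  (1 - expR (- (v n * y))) ^+ N n @[n --> \oo] --> ((c < y)%R%:R : R).
Proof.
have exp01 (t : R) : 0 <= t -> 0 <= expR (- t) <= 1.
  by move=> t0; rewrite expR_ge0/= expR_le1 oppr_le0.
have inv0 (k : R) : k * n.+1%:R^-1 @[n --> \oo] --> (0 : R).
  by rewrite -(mulr0 k); apply: cvgMr => //; exact: cvg_harmonic.
rewrite le_eqVlt => /predU1P[<-|c0].
  (* For c = 0 there is no rate n ln 2 / c. A single factor 1 - exp(- (n + 1) y) already separates 0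
     from the positive reals. *)
  exists (fun n => n.+1%:R), (fun=> 1%N); split=> // y.
  rewrite le_eqVlt => /predU1P[<-|y0].
    rewrite ltxx; apply: cvg_near_cst; near=> n.
    by rewrite mulr0 oppr0 expR0 subrr expr1.
  rewrite y0 -[X in _ --> X]subr0.
  apply: cvgB; first exact: cvg_cst.
  apply: (@squeeze_cvgr _ _ _ _ (cst 0) (fun n => 4 / y ^+ 2 * n.+1%:R^-1)).
  - near=> n; rewrite expR_ge0/=; apply: le_trans (natr_expR_le _ y0).
    by rewrite ler_peMl ?expR_ge0// ler1n.
  - exact: cvg_cst.
  - exact: inv0.
have l2 : 0 < ln 2 :> R by rewrite ln_gt0// ltr1n.
exists (fun n => n.+1%:R * ln 2 / c), (fun n => n.+1 * 2 ^ n.+1)%N; split.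
  by move=> n; rewrite divr_ge0 ?mulr_ge0// ltW.
move=> y y0.
have two n : (2 ^ n)%:R = expR (n%:R * ln 2) :> R.
  by rewrite natrX -powR_mulrn// /powR pnatr_eq0.
(* The power of 2 shifts the decay rate from ln 2 (y / c) to ln 2 (y / c - 1), whose sign tells on
   which side of c the point lies. *)
have NxE n : (n.+1 * 2 ^ n.+1)%:R * expR (- (n.+1%:R * ln 2 / c * y)) =
    n.+1%:R * expR (- (n.+1%:R * (ln 2 * (y / c - 1)))) :> R.
  rewrite natrM -mulrA two -expRD; congr (_ * expR _).
  by field; rewrite gt_eqF.
have x01 n : 0 <= expR (- ((n.+1%:R : R) * ln 2 / c * y)) <= 1.
  by apply: exp01; rewrite !mulr_ge0 ?invr_ge0// ltW.
have [cy|yc] := ltP c y.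
  have l0 : 0 < ln 2 * (y / c - 1) by rewrite mulr_gt0// subr_gt0 ltr_pdivlMr ?mul1r.
  (* For c < y, Bernoulli's inequality bounds the power below by 1 - N x, where x is the
     exponential, and N x tends to 0. *)
  apply: (@squeeze_cvgr _ _ _ _
    (fun n => 1 - 4 / (ln 2 * (y / c - 1)) ^+ 2 * n.+1%:R^-1) (cst 1)).
  - near=> n; apply/andP; split.
      apply: le_trans (bernoulli_ineq _ (x01 n)).
      by rewrite lerB// NxE; exact: natr_expR_le.
    by case/andP: (x01 n) => ? ?; apply: exprn_ile1; rewrite ?subr_ge0 ?gerBl.
  - rewrite -[X in _ --> X]subr0; apply: cvgB; first exact: cvg_cst.
    exact: inv0.
  - exact: cvg_cst.
(* For y <= c, N x >= n + 1, and (1 - x)^N <= exp(- N x) <= 1 / (n + 1). *)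
apply: (@squeeze_cvgr _ _ _ _ (cst 0) (fun n => 1 * n.+1%:R^-1)).
- near=> n; apply/andP; split.
    by rewrite exprn_ge0// subr_ge0; case/andP: (x01 n).
  set x := expR _; set M := (_ * _)%N.
  apply: (@le_trans _ _ (expR (- x) ^+ M)).
    apply: lerXn2r; rewrite ?nnegrE ?expR_ge0// ?subr_ge0.
      by case/andP: (x01 n).
    exact: expR_ge1Dx.
  rewrite -expRM_natl mulrN NxE [leRHS]mul1r [leLHS]expRN.
  rewrite lef_pV2 ?posrE ?expR_gt0//.
  apply: le_trans (expR_ge1Dx _); apply: (@le_trans _ _ (n.+1%:R * 1)).
    by rewrite mulr1.
  rewrite ler_wpDl// ler_wpM2l//; apply: le_trans (expR_ge1Dx _).
  rewrite lerDl oppr_ge0 mulr_ge0_le0// mulr_ge0_le0 ?(ltW l2)// subr_le0.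
  by rewrite ler_pdivrMr ?mul1r.
- exact: cvg_cst.
- exact: inv0.
Unshelve. all: by end_near.
Qed.
End step_kernel.

(** * Exponential sums and the linear functionals on them *)

Section lincomb.
Context {R : realType}.
Implicit Types (s : seq (R * R)) (phi : R -> R) (c u v y : R).

(** A pair (c, u) encodes the term c exp(- u y), and [phi u] is the value of a linear functional at
    exp(- u y). Keeping the list rather than the function it represents makes the functional well
    defined by construction. *)
Definition lincomb s phi : R := \sum_(x <- s) x.1 * phi x.2.

Definition expsum s y : R := lincomb s (fun u => expR (- (u * y))).

Lemma lincomb_cons x s phi : lincomb (x :: s) phi = x.1 * phi x.2 + lincomb s phi.
Proof. by rewrite /lincomb big_cons. Qed.

Lemma lincomb1 c u phi : lincomb [:: (c, u)] phi = c * phi u.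
Proof. by rewrite /lincomb big_seq1. Qed.

Lemma lincomb_cat s t phi : lincomb (s ++ t) phi = lincomb s phi + lincomb t phi.
Proof. by rewrite /lincomb big_cat. Qed.

Lemma lincomb_map c v s phi :
  lincomb [seq (c * x.1, x.2 + v) | x <- s] phi =
  c * lincomb s (fun u => phi (u + v)).
Proof.
by rewrite /lincomb big_map mulr_sumr; apply: eq_bigr => x _; rewrite mulrA.
Qed.

Lemma lincomb_shift_exp v s y :
  lincomb s (fun u => expR (- ((u + v) * y))) = expR (- (v * y)) * expsum s y.
Proof.
rewrite /expsum /lincomb mulr_sumr; apply: eq_bigr => x _.
by rewrite mulrDl opprD expRD; ring.
Qed.

(** Multiplication by 1 - exp(- v y) on lists; iterating it turns the step kernels into exponential
    sums. *)
Definition mul_onem_exp v s := s ++ [seq (-1 * x.1, x.2 + v) | x <- s].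

Lemma expsum_mul_onem v N s y :
  expsum (iter N (mul_onem_exp v) s) y =
  (1 - expR (- (v * y))) ^+ N * expsum s y.
Proof.
elim: N => [|N ih] /=; first by rewrite expr0 mul1r.
rewrite {1}/expsum lincomb_cat lincomb_map lincomb_shift_exp -/(expsum _ _) ih.
by rewrite exprS; ring.
Qed.

Lemma all_mul_onem (a : pred R) v N s :
  {homo +%R^~ v : u / u \in a} -> all (fun x => x.2 \in a) s ->
  all (fun x => x.2 \in a) (iter N (mul_onem_exp v) s).
Proof.
move=> av sa; elim: N => [//|N ih] /=; rewrite /mul_onem_exp all_cat ih/=.
apply/allP => _ /mapP[x xs ->] /=; apply: av.
by have /allP := ih; exact.
Qed.

Lemma measurable_expsum s : measurable_fun [set: R] (expsum s).
Proof.
elim: s => [|x s ih].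
  rewrite (_ : expsum _ = cst 0)//; apply/funext => y.
  by rewrite /expsum /lincomb big_nil.
rewrite (_ : expsum _ = fun y => x.1 * expR (- (x.2 * y)) + expsum s y).
  apply: measurable_funD => //; apply: measurable_funM => //.
  apply: (measurableT_comp (@measurable_expR R)); apply: measurableT_comp => //.
by apply/funext => y; rewrite /expsum lincomb_cons.
Qed.

End lincomb.

Section laplace_transform.
Local Open Scope ereal_scope.
Context (R : realType) d (T : measurableType d) (mu : {measure set T -> \bar R}).
Variables (w Y : T -> R) (L : R -> R).
Hypotheses (mw : measurable_fun [set: T] w) (w0 : forall x, (0 <= w x)%R).
Hypotheses (mY : measurable_fun [set: T] Y) (Y0 : forall x, (0 <= Y x)%R).
(** The arguments where the transform is known: the positive ones for uniqueness, the nonnegative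
    ones for positivity of the functional. *)
Variable a : {pred R}.
Hypothesis LE : forall u, u \in a ->
  \int[mu]_x (w x * expR (- (u * Y x)))%:E = (L u)%:E.

Let mexp u : measurable_fun [set: T] (fun x => (w x * expR (- (u * Y x)))%R).
Proof.
apply: measurable_funM => //; apply: (measurableT_comp (@measurable_expR R)).
by apply: measurableT_comp => //; exact: measurable_funM.
Qed.

Lemma laplace_integrable u : u \in a ->
  mu.-integrable setT (fun x => (w x * expR (- (u * Y x)))%:E).
Proof.
move=> u0; apply/integrableP; split; first exact/measurable_EFinP.
under eq_integral do rewrite gee0_abs ?lee_fin ?mulr_ge0 ?expR_ge0//.
by rewrite LE// ltry.
Qed.

Lemma integral_expsum s : all (fun x => x.2 \in a) s ->
  mu.-integrable setT (fun x => (w x * expsum s (Y x))%:E) /\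
  \int[mu]_x (w x * expsum s (Y x))%:E = (lincomb s L)%:E.
Proof.
elim: s => [|[c u] s ih] /=.
  move=> _.
  rewrite /expsum /lincomb; under eq_fun do rewrite big_nil mulr0.
  by split; [exact: integrable0|rewrite integral0 big_nil].
move=> /andP[u0 /ih[iS Es]].
have E x : (w x * expsum ((c, u) :: s) (Y x))%:E =
    c%:E * (w x * expR (- (u * Y x)))%:E + (w x * expsum s (Y x))%:E.
  by rewrite /expsum lincomb_cons /= -EFinM -EFinD; congr EFin; ring.
have iu : mu.-integrable setT (fun x => c%:E * (w x * expR (- (u * Y x)))%:E).
  by apply: integrableZl => //; exact: laplace_integrable.
under eq_fun do rewrite E.
split; first exact: integrableD.
rewrite integralD// integralZl//; last exact: laplace_integrable.
by rewrite LE// Es lincomb_cons EFinD.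
Qed.

End laplace_transform.

Section laplace_ray.
Local Open Scope ereal_scope.
Context (R : realType) d (T : measurableType d) (mu : {measure set T -> \bar R}).
Variables (w Y : T -> R) (L : R -> R).
Hypotheses (mw : measurable_fun [set: T] w) (w0 : forall x, (0 <= w x)%R).
Hypotheses (mY : measurable_fun [set: T] Y) (Y0 : forall x, (0 <= Y x)%R).
Hypothesis LE : forall u, (0 < u)%R ->
  \int[mu]_x (w x * expR (- (u * Y x)))%:E = (L u)%:E.

(** Dominated convergence along the step kernels. Starting from the list for exp(- y) keeps all
    exponents positive, where [L] is known, and provides the integrable bound w exp(- Y). *)
Lemma laplace_ray c (v : nat -> R) (N : nat -> nat) :
  (forall n, (0 <= v n)%R) ->
  (forall y, (0 <= y)%R ->
    ((1 - expR (- (v n * y))) ^+ N n @[n --> \oo] --> ((c < y)%R%:R : R))%R) ->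
  (lincomb (iter (N n) (mul_onem_exp (v n)) [:: (1, 1)]) L)%:E @[n --> \oo] -->
  \int[mu]_x ((w x * expR (- Y x))%:E * (\1_(`]c, +oo[ : set R) (Y x))%:E).
Proof.
move=> v0 vN; pose s n := iter (N n) (mul_onem_exp (v n)) [:: (1, 1)]%R.
have s_pos n : all (fun x : R * R => x.2 \in Num.pos) (s n).
  apply: all_mul_onem; last by rewrite /= posrE ltr01.
  by move=> u; rewrite !posrE => u0; rewrite ltr_wpDr.
have LEa u : u \in Num.pos ->
    \int[mu]_x (w x * expR (- (u * Y x)))%:E = (L u)%:E by move/LE.
have sE n y : expsum (s n) y = ((1 - expR (- (v n * y))) ^+ N n * expR (- y))%R.
  by rewrite expsum_mul_onem /expsum lincomb1 !mul1r.
under eq_fun do rewrite -(integral_expsum mw w0 mY LEa (s_pos _)).2.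
apply: (@dominated_cvg _ _ _ mu setT measurableT _ _
  (fun x => (w x * expR (- Y x))%:E)) => //.
- move=> n; apply/measurable_EFinP; apply: measurable_funM => //.
  exact: (measurableT_comp (measurable_expsum _)).
- move=> x _; rewrite -EFinM; apply: cvg_EFin; first exact: nearW.
  have -> : \1_(`]c, +oo[ : set R) (Y x) = (c < Y x)%R%:R :> R.
    by rewrite indicE mem_setE in_itv/= andbT.
  have : (w x * expR (- Y x) * (1 - expR (- (v n * Y x))) ^+ N n @[n --> \oo] -->
      w x * expR (- Y x) * (c < Y x)%R%:R)%R.
    by apply: cvgM; [exact: cvg_cst|exact: vN].
  apply: cvg_trans; apply: near_eq_cvg; apply: nearW => n /=.
  by rewrite sE; ring.
- rewrite (_ : (fun _ => _) = fun x => (w x * expR (- (1 * Y x)))%:E).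
    by apply: (laplace_integrable mw w0 mY LEa); rewrite posrE ltr01.
  by apply/funext => x; rewrite mul1r.
move=> n x _; rewrite lee_fin sE normrM (ger0_norm (w0 x)) ler_wpM2l//.
rewrite normrM (ger0_norm (expR_ge0 _)) ler_piMl ?expR_ge0// normrX.
have e01 : (0 <= 1 - expR (- (v n * Y x)) <= 1)%R.
  by rewrite subr_ge0 gerBl expR_ge0 expR_le1 oppr_le0 mulr_ge0.
by case/andP: e01 => e0 e1; rewrite ger0_norm// exprn_ile1.
Qed.

End laplace_ray.

(** The images under [Y1] and [Y2] of the weights w exp(- Y) have finite mass [L 1] and agree on the
    rays ]c, +oo[, a generating family closed under intersection. A general test function [g] allows
    the weight to be undone afterwards. *)
Lemma laplace_unique (R : realType)
    d1 (T1 : measurableType d1) (m1 : {measure set T1 -> \bar R}) (w1 Y1 : T1 -> R)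
    d2 (T2 : measurableType d2) (m2 : {measure set T2 -> \bar R}) (w2 Y2 : T2 -> R)
    (L : R -> R) :
  measurable_fun [set: T1] w1 -> (forall x, 0 <= w1 x) ->
  measurable_fun [set: T1] Y1 -> (forall x, 0 <= Y1 x) ->
  measurable_fun [set: T2] w2 -> (forall x, 0 <= w2 x) ->
  measurable_fun [set: T2] Y2 -> (forall x, 0 <= Y2 x) ->
  (forall u, 0 < u ->
    (\int[m1]_x (w1 x * expR (- (u * Y1 x)))%:E = (L u)%:E)%E) ->
  (forall u, 0 < u ->
    (\int[m2]_x (w2 x * expR (- (u * Y2 x)))%:E = (L u)%:E)%E) ->
  forall g : R -> \bar R, measurable_fun [set: R] g -> (forall y, (0 <= g y)%E) ->
  (\int[m1]_x ((w1 x * expR (- Y1 x))%:E * g (Y1 x)) =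
   \int[m2]_x ((w2 x * expR (- Y2 x))%:E * g (Y2 x)))%E.
Proof.
move=> mw1 w10 mY1 Y10 mw2 w20 mY2 Y20 L1 L2.
pose W1 x := w1 x * expR (- Y1 x); pose W2 x := w2 x * expR (- Y2 x).
have mW1 : measurable_fun [set: T1] W1.
  apply: measurable_funM => //; apply: (measurableT_comp (@measurable_expR R)).
  exact: measurableT_comp.
have mW2 : measurable_fun [set: T2] W2.
  apply: measurable_funM => //; apply: (measurableT_comp (@measurable_expR R)).
  exact: measurableT_comp.
have W10 x : 0 <= W1 x by rewrite mulr_ge0// expR_ge0.
have W20 x : 0 <= W2 x by rewrite mulr_ge0// expR_ge0.
have [nu1 nu1E] := weighted_measure m1 mW1 W10 mY1.
have [nu2 nu2E] := weighted_measure m2 mW2 W20 mY2.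
have mray c : measurable (`]c, +oo[ : set R) by exact: measurable_itv.
have L1' c (v : nat -> R) N := laplace_ray mw1 w10 mY1 Y10 L1 (c := c) (v := v) (N := N).
have L2' c (v : nat -> R) N := laplace_ray mw2 w20 mY2 Y20 L2 (c := c) (v := v) (N := N).
have ray0 c : 0 <= c -> nu1 `]c, +oo[%classic = nu2 `]c, +oo[%classic.
  move=> /step_kernel[v [N [v0 vN]]]; rewrite nu1E// nu2E//.
  by apply: cvg_unique (L1' _ _ _ v0 vN) (L2' _ _ _ v0 vN).
have W1I : (\int[m1]_x (W1 x)%:E = (L 1)%:E)%E.
  by rewrite -(L1 _ ltr01); apply: eq_integral => x _; rewrite mul1r.
have W2I : (\int[m2]_x (W2 x)%:E = (L 1)%:E)%E.
  by rewrite -(L2 _ ltr01); apply: eq_integral => x _; rewrite mul1r.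
(* For c < 0 the ray contains every value of [Y1] and [Y2], so both sides are the total mass
   [L 1]. *)
have rayN c : c < 0 -> nu1 `]c, +oo[%classic = nu2 `]c, +oo[%classic.
  move=> c0; rewrite nu1E// nu2E//; transitivity (L 1)%:E; last apply/esym.
    rewrite -W1I; apply: eq_integral => x _; rewrite indicE mem_set ?mule1//=.
    by rewrite in_itv/= andbT (lt_le_trans c0).
  rewrite -W2I; apply: eq_integral => x _; rewrite indicE mem_set ?mule1//=.
  by rewrite in_itv/= andbT (lt_le_trans c0).
have fin1 c : (nu1 `]c, +oo[%classic < +oo)%E.
  rewrite nu1E//; apply: (@le_lt_trans _ _ (L 1)%:E); last exact: ltry.
  rewrite -W1I; apply: ge0_le_integral => //.
  - by move=> x _; rewrite mule_ge0 ?lee_fin.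
  - apply: emeasurable_funM; first exact/measurable_EFinP.
    by apply/measurable_EFinP; apply: measurableT_comp.
  - exact/measurable_EFinP.
  - by move=> x _; rewrite -EFinM lee_fin ler_piMr.
move=> g mg g0.
rewrite -(ge0_integral_weighted mW1 W10 mY1 nu1E mg g0).
rewrite -(ge0_integral_weighted mW2 W20 mY2 nu2E mg g0).
apply: eq_measure_integral => A mA _.
apply: (@measure_unique _ R R (@RGenOInfty.G R) (fun n => `](- n%:R), +oo[%classic)).
- exact: RGenOInfty.measurableE.
- move=> _ _ [a ->] [b ->]; exists (Num.max a b).
  apply/seteqP; split => x /=; rewrite !in_itv/= !andbT gt_max.
    by case=> -> ->.
  by case/andP.
- by move=> n; exists (- n%:R).
- apply/seteqP; split => // x _; exists (Num.bound `|x|) => //=.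
  rewrite in_itv/= andbT ltrNl.
  apply: le_lt_trans (archi_boundP (normr_ge0 x)); rewrite -normrN.
  exact: ler_norm.
- move=> _ [c ->]; have [c0|c0] := ltP c 0; [exact: rayN|exact: ray0].
- by move=> n; exact: fin1.
- exact: mA.
Qed.

(** * Necessity of the condition and uniqueness of the factor *)

Section antitone.
Context {R : realType}.
Local Notation mu := (@lebesgue_measure R).

Lemma ae_dense (A : set R) : {ae mu, forall y, A y} ->
  forall a b : R, a < b -> exists2 y, a < y < b & A y.
Proof.
move=> [N [mN N0 AN]] a b ab; apply: contrapT => /forall2NP noA.
suff : (mu `]a, b[%classic = 0)%E.
  rewrite lebesgue_measure_itv/= lte_fin ab => /eqP.
  by rewrite -EFinB eqe subr_eq0 gt_eqF.
apply: (subset_measure0 _ mN) => //.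
move=> y /=; rewrite in_itv/= => aby; apply: AN => /= Ay.
by have [] := noA y.
Qed.

(* An antitone function that agrees almost everywhere with a continuous one is
   squeezed between its values at nearby points of agreement. *)
Lemma antitone_ae_eq (F : R -> \bar R) (f : R -> R) :
  (forall x y, 0 < x -> x <= y -> (F y <= F x)%E) ->
  {ae mu, forall y, (f y)%:E = F y} ->
  (forall y, 0 < y -> {for y, continuous f}) ->
  forall y, 0 < y -> F y = (f y)%:E.
Proof.
move=> Fanti fF fc y y0.
have approx e : 0 < e -> exists2 d, 0 < d & forall z, `|y - z| < d -> `|f y - f z| < e.
  move=> e0; have /cvgrPdist_lt/(_ _ e0) := fc y y0.
  by move=> /nbhs_ballP[d /= d0 dP]; exists d => // z; exact: dP.
apply/eqP; rewrite eq_le; apply/andP; split; apply/lee_addgt0Pr => e e0;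
  have [d d0 dP] := approx _ e0.
- have [|z /andP[z1 z2] fz] := ae_dense fF (_ : Num.max 0 (y - d) < y).
    by rewrite gt_max y0 gtrBl.
  move: z1; rewrite gt_max => /andP[z0 z1].
  apply: le_trans (Fanti z y z0 (ltW z2)) _; rewrite -fz -EFinD lee_fin.
  have /dP : `|y - z| < d by rewrite ltr_norml; apply/andP; split; lra.
  rewrite ltr_norml => /andP[? ?]; lra.
- have [|z /andP[z1 z2] fz] := ae_dense fF (_ : y < y + d).
    by rewrite ltrDl.
  apply: (@le_trans _ _ (F z + e%:E)%E); last by rewrite leeD2r// Fanti// ltW.
  rewrite -fz -EFinD lee_fin.
  have /dP : `|y - z| < d by rewrite ltr_norml; apply/andP; split; lra.
  rewrite ltr_norml => /andP[? ?]; lra.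
Qed.

Lemma continuous_gen_normal_pdf (p y : R) : 0 < y ->
  {for y, continuous (gen_normal_pdf p)}.
Proof.
move=> y0; apply: cvgM; first exact: cvg_cst.
apply: continuous_comp; last exact: continuous_expR.
apply: cvgN; apply: cvgM; last exact: cvg_cst.
have lncvg : expR (p * ln z) @[z --> y] --> expR (p * ln y).
  apply: (continuous_comp (f := fun z => p * ln z)); last exact: continuous_expR.
  by apply: cvgM; [exact: cvg_cst|exact: continuous_ln].
have E z : 0 < z -> `|z| `^ p = expR (p * ln z).
  by move=> z0; rewrite gtr0_norm// /powR gt_eqF.
rewrite /continuous_at E//; apply: cvg_trans lncvg; apply: near_eq_cvg.
by near=> z; rewrite E//; near: z; exact: lt_nbhsr.
Unshelve. all: by end_near. Qed.

End antitone.

Section mixture.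
Variables (R : realType) (p q : R).
Hypotheses (p0 : 0 < p) (q0 : 0 < q).
Local Notation mu := (@lebesgue_measure R).
Context dp (Tp : measurableType dp) (Pp : probability Tp R) (Xp : Tp -> R).
Hypothesis Xp_law : gen_normal p Pp Xp.
Context d (T : measurableType d) (P : probability T R) (X V : {RV P >-> R}).
Hypothesis X_law : gen_normal q P X.
Hypothesis V_factor : scale_factor P V X (pushforward Pp Xp).

Let w (x : T) : R := `|V x|^-1.
Let Y (x : T) : R := `|V x|^-1 `^ q.

Lemma measurable_inv_norm : measurable_fun [set: T] (fun x => `|V x|^-1).
Proof.
apply: (measurableT_comp (@measurable_inv R)).
exact: measurableT_comp.
Qed.

Lemma measurable_inv_norm_powR : measurable_fun [set: T] (fun x => `|V x|^-1 `^ q).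
Proof.
apply: (measurableT_comp (measurable_powR q)); exact: measurable_inv_norm.
Qed.

Let mw := measurable_inv_norm.
Let mY := measurable_inv_norm_powR.
Let w0 x : 0 <= w x. Proof. by rewrite invr_ge0. Qed.
Let Y0 x : 0 <= Y x. Proof. exact: powR_ge0. Qed.

Let Kp := (gen_normal_mass p0 Xp_law).1.
Let Kq := (gen_normal_mass q0 X_law).1.

Let densityE (y : R) x : `|V x|^-1 * gen_normal_pdf q (y / V x) =
  gen_normal_cst q * (w x * expR (- (`|y| `^ q / 2 * Y x))).
Proof.
rewrite gen_normal_pdfE mulrCA; congr (_ * (_ * expR _)).
by rewrite normrM normfV powRM// ?invr_ge0// mulrAC.
Qed.

Let mexp u : measurable_fun [set: T] (fun x => w x * expR (- (u * Y x))).
Proof.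
apply: measurable_funM => //; apply: (measurableT_comp (@measurable_expR R)).
by apply: measurableT_comp => //; exact: measurable_funM.
Qed.

(** Both sides are densities of the law of [Xp], hence equal almost everywhere. The left one is
    antitone on y > 0 because |y|^q increases, so [antitone_ae_eq] applies. *)
Lemma mixture_density (y : R) : 0 < y ->
  (\int[P]_x (`|V x|^-1 * gen_normal_pdf q (y / V x))%:E =
   (gen_normal_pdf p y)%:E)%E.
Proof.
pose F y := (\int[P]_x (`|V x|^-1 * gen_normal_pdf q (y / V x))%:E)%E.
move: y; apply: (@antitone_ae_eq R F).
- move=> y z y0 yz; apply: ge0_le_integral; first exact: measurableT.
  + by move=> x _; rewrite lee_fin mulr_ge0// gen_normal_pdf_ge0.
  + under eq_fun do rewrite densityE; exact/measurable_EFinP/measurable_funM.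
  + by under eq_fun do rewrite densityE; exact/measurable_EFinP/measurable_funM.
  + move=> x _; rewrite lee_fin [leLHS]densityE [leRHS]densityE.
    apply: ler_wpM2l; first exact: ltW Kq.
    apply: ler_wpM2l; first exact: w0.
    rewrite ler_expR lerN2; apply: ler_wpM2r; first exact: Y0.
    apply: ler_wpM2r; first by rewrite invr_ge0.
    apply: ge0_ler_powR; [exact: ltW|by rewrite nnegrE|by rewrite nnegrE|].
    by rewrite !gtr0_norm// (lt_le_trans y0).
- pose k (z : T * measurableTypeR R) : \bar R :=
    (gen_normal_cst q * (w z.1 * expR (- (`|z.2| `^ q / 2 * Y z.1))))%:E.
  have mk : measurable_fun [set: T * measurableTypeR R] k.
    apply/measurable_EFinP; apply: measurable_funM => //.
    apply: measurable_funM; first exact: (measurableT_comp mw).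
    apply: (measurableT_comp (@measurable_expR R)); apply: measurableT_comp => //.
    apply: measurable_funM; last exact: (measurableT_comp mY).
    apply: measurable_funM => //.
    apply: (measurableT_comp (measurable_powR q)).
    by apply: measurableT_comp.
  have k0 z : (0 <= k z)%E.
    rewrite lee_fin; apply: mulr_ge0; first exact: ltW Kq.
    by apply: mulr_ge0; [exact: w0|exact: expR_ge0].
  have FE : F = fun y => (\int[P]_x k (x, y))%E.
    by apply/funext => y; apply: eq_integral => x _; rewrite densityE.
  have mF : measurable_fun [set: measurableTypeR R] F.
    rewrite FE.
    exact: (@measurable_fun_fubini_tonelli_G _ _ T (measurableTypeR R) R P
      k mk k0).
  have ip : mu.-integrable [set: R] (fun y => (gen_normal_pdf p y)%:E).
    apply/integrableP; split.
      apply/measurable_EFinP; exact: (measurable_gen_normal_pdf p).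
    under eq_integral do rewrite gee0_abs ?lee_fin ?gen_normal_pdf_ge0//.
    by rewrite -(Xp_law measurableT) /pushforward preimage_setT probability_setT ltry.
  have := @integral_ae_eq _ _ R mu setT measurableT F _ ip mF.
  case: V_factor => V_gt0 ind law.
  case.
    move=> A _ mA; rewrite -(Xp_law mA) -(law A mA).
    rewrite (scale_product_law V_gt0 ind (measurable_gen_normal_pdf q) _ X_law mA)//.
    by move=> x; exact: gen_normal_pdf_ge0.
  move=> N [mN N0 sN]; exists N; split => //.
  by apply: subset_trans sN => y /= nE /(_ I).
- by move=> y y0; exact: continuous_gen_normal_pdf.
Qed.

Lemma mixture_laplace (u : R) : 0 < u ->
  (\int[P]_x (`|V x|^-1 * expR (- (u * `|V x|^-1 `^ q)))%:E =
   (gen_normal_cst p / gen_normal_cst q * expR (- ((2 * u) `^ (p / q) / 2)))%:E)%E.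
Proof.
(* The point at which the Laplace argument y^q / 2 is u. *)
move=> u0; set y := (2 * u) `^ q^-1.
have y0 : 0 < y by rewrite powR_gt0 ?mulr_gt0.
have := mixture_density y0.
under eq_integral do rewrite densityE EFinM.
rewrite ge0_integralZl; last 4 first.
- exact: measurableT.
- exact/measurable_EFinP.
- by move=> x _; rewrite lee_fin; apply: mulr_ge0; [exact: w0|exact: expR_ge0].
- by rewrite lee_fin; exact: ltW Kq.
have yq : `|y| `^ q / 2 = u.
  rewrite gtr0_norm// -powRrM mulVf ?gt_eqF// powRr1 ?mulr_ge0 ?ltW//.
  by field.
have yp : `|y| `^ p = (2 * u) `^ (p / q).
  by rewrite gtr0_norm// -powRrM (mulrC q^-1).
rewrite yq gen_normal_pdfE /gen_normal_exp yp => E.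
transitivity ((gen_normal_cst q)^-1%:E * ((gen_normal_cst q)%:E *
    \int[P]_x (w x * expR (- (u * Y x)))%:E))%E.
  by rewrite muleA -EFinM mulVf ?mul1e// (lt0r_neq0 Kq).
rewrite [X in (_ * X)%E]E -EFinM; congr EFin.
by rewrite mulrCA mulrA.
Qed.

End mixture.

Section scale_factor_consequences.
Variables (R : realType) (p q : R).
Hypotheses (p0 : 0 < p) (q0 : 0 < q).
Context dp (Tp : measurableType dp) (Pp : probability Tp R) (Xp : Tp -> R).
Hypothesis Xp_law : gen_normal p Pp Xp.

(** With u^(alpha - 1) = n + m and u >= 1, u^alpha = u n + u m >= u n + m; the factor 2^alpha >= 2
    pays for the halving. *)
Lemma powR_superlinear (alpha n m : R) : 1 < alpha -> 1 <= n -> 0 <= m ->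
  exists2 u, 0 < u & u * n + m <= (2 * u) `^ alpha / 2.
Proof.
move=> alpha1 n1 m0; set M := n + m; set u := M `^ (alpha - 1)^-1.
have M1 : 1 <= M by rewrite ler_wpDr.
have u1 : 1 <= u.
  by rewrite -(powRr0 M) ler_powR// invr_ge0 subr_ge0 ltW.
have u0 : 0 < u by rewrite (lt_le_trans _ u1).
exists u => //; apply: (@le_trans _ _ (u `^ alpha)).
  have -> : u `^ alpha = u * M.
    rewrite -(subrK 1 alpha) addrC powRD; last by rewrite (lt0r_neq0 u0) implybT.
    rewrite powRr1 ?(ltW u0)// -powRrM mulVf ?subr_eq0 ?gt_eqF//.
    by rewrite powRr1// (le_trans _ M1).
  by rewrite mulrDr lerD2l ler_peMl.
rewrite powRM ?(ltW u0)// ler_pdivlMr// mulrC ler_wpM2r ?powR_ge0//.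
by rewrite -[leLHS]powRr1// ler_powR ?ler1n// ltW.
Qed.

Lemma scale_factor_exponent_le d (T : measurableType d) (P : probability T R)
    (X V : {RV P >-> R}) :
  gen_normal q P X -> scale_factor P V X (pushforward Pp Xp) -> p <= q.
Proof.
move=> X_law VX; rewrite leNgt; apply/negP => qp.
have laplace := mixture_laplace p0 q0 Xp_law X_law VX.
have mw := measurable_inv_norm V; have mY := measurable_inv_norm_powR q V.
set w := (fun x => `|V x|^-1) in mw; set Y := (fun x => `|V x|^-1 `^ q) in mY.
set C := _ / _ in laplace.
have C0 : 0 <= C.
  have Kp := (gen_normal_mass p0 Xp_law).1; have Kq := (gen_normal_mass q0 X_law).1.
  exact: divr_ge0 (ltW Kp) (ltW Kq).
(* Where V > 0, [w] is positive and [Y] is finite, so these sets cover almost everything and one of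
   them has positive probability. There w exp(- u Y) is at least exp(- u N) / N with N = n + 1. *)
pose A n := [set x | n.+1%:R^-1 <= w x] `&` [set x | Y x <= n.+1%:R].
have mA n : measurable (A n).
  apply: measurableI.
    rewrite (_ : mkset _ = w @^-1` `[n.+1%:R^-1, +oo[); last first.
      by apply/seteqP; split => x /=; rewrite in_itv/= andbT.
    by rewrite -[X in measurable X]setTI; exact: mw.
  rewrite (_ : mkset _ = Y @^-1` `]-oo, n.+1%:R]); last first.
    by apply/seteqP; split => x /=; rewrite in_itv.
  by rewrite -[X in measurable X]setTI; exact: mY.
have [n PA] : exists n, (0 < P (A n))%E.
  apply: contrapT => /forallNP PA0.
  have : \forall x \ae P, forall n, ~ A n x.
    apply: ae_foralln => n; exists (A n); split => //.
      by apply/eqP; rewrite eq_le measure_ge0 andbT leNgt; apply/negP/PA0.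
    by move=> x /contrapT.
  case: VX => V_gt0 _ _.
  have PT : (0 < P setT)%E by rewrite probability_setT.
  have pf := ae_properfilter_algebraOfSetsType PT.
  move=> nA; have [x [Vx /(_ (Num.bound (Num.max (w x)^-1 (Y x)))) []]] :=
    filter_ex (filterI V_gt0 nA).
  have wx : 0 < w x by rewrite invr_gt0 normr_gt0 gt_eqF.
  have := archi_boundP (_ : 0 <= Num.max (w x)^-1 (Y x)).
  rewrite le_max invr_ge0 (ltW wx)/= => /(_ isT).
  set k := Num.bound _; rewrite gt_max => /andP[wk Yk].
  have kk : k%:R <= k.+1%:R :> R by rewrite ler_nat.
  split => /=; last by rewrite (le_trans (ltW Yk)).
  rewrite -[w x]invrK lef_pV2 ?posrE 1?invr_gt0//.
  by rewrite (le_trans (ltW wk)).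
pose N : R := n.+1%:R; have N1 : 1 <= N by rewrite ler1n.
have N0 : 0 < N by rewrite ltr0n.
have Afin : P (A n) \is a fin_num by exact: fin_num_measure.
pose delta := fine (P (A n)).
have dE : P (A n) = delta%:E by rewrite fineK.
have delta0 : 0 < delta by rewrite -lte_fin -dE.
have lower u : 0 < u ->
    N^-1 * expR (- (u * N)) * delta <= C * expR (- ((2 * u) `^ (p / q) / 2)).
  move=> u0; rewrite -lee_fin -laplace// EFinM -dE -[A n]setIT -integral_indic//.
  rewrite -ge0_integralZl//; last 2 first.
  - exact/measurable_EFinP.
  - by rewrite lee_fin mulr_ge0 ?invr_ge0 ?expR_ge0// ltW.
  apply: ge0_le_integral => //.
  - move=> x _; apply: mule_ge0; rewrite lee_fin//.
    by rewrite mulr_ge0 ?invr_ge0 ?expR_ge0// ltW.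
  - by apply: emeasurable_funM => //; exact/measurable_EFinP.
  - apply/measurable_EFinP; apply: measurable_funM => //.
    apply: (measurableT_comp (@measurable_expR R)); apply: measurableT_comp => //.
    exact: measurable_funM.
  move=> x _; rewrite -EFinM lee_fin indicE.
  have [|_] := boolP (x \in A n); last first.
    by rewrite mulr0 mulr_ge0 ?expR_ge0// invr_ge0.
  rewrite inE mulr1 => -[/= wx Yx]; apply: ler_pM => //; first by rewrite invr_ge0 ltW.
  by rewrite ler_expR lerN2; apply: ler_wpM2l => //; exact: ltW u0.
(* Call this quantity m. For the u found below, the lower bound delta exp(- u N) / N would be at
   most C exp(- u N - m), that is exp m <= m, against exp m >= 1 + m. *)
have m0 : 0 <= C * N / delta.
  exact: divr_ge0 (mulr_ge0 C0 (ltW N0)) (ltW delta0).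
have [|u u0 hu] := @powR_superlinear (p / q) N _ _ N1 m0.
  by rewrite ltr_pdivlMr// mul1r.
have := lower u u0; apply/negP; rewrite -ltNge.
apply: (@le_lt_trans _ _ (C * (expR (- (u * N)) / expR (C * N / delta)))).
  by rewrite ler_wpM2l// -expRB ler_expR -opprD lerN2.
set e := expR (- _); have e0 : 0 < e by exact: expR_gt0.
rewrite mulrCA (mulrC N^-1) -[ltRHS]mulrA ltr_pM2l//.
rewrite ltr_pdivrMr ?expR_gt0// mulrC -ltr_pdivrMr; last by rewrite mulr_gt0 ?invr_gt0.
apply: (@lt_le_trans _ _ (1 + C * N / delta)); last exact: expR_ge1Dx.
have -> : C / (N^-1 * delta) = C * N / delta by field; rewrite !gt_eqF.
by rewrite ltrDr.
Qed.

(* With w = 1/V and Y = V^-q, the function g integrated here satisfies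
   w exp(-Y) g(Y) = 1_A(V). *)
Lemma scale_factor_laplace_test d (T : measurableType d) (P : probability T R)
    (V : {RV P >-> R}) (A : set R) : {ae P, forall x, 0 < V x} -> measurable A ->
  distribution P V A =
  (\int[P]_x ((`|V x|^-1 * expR (- (`|V x|^-1 `^ q)))%R%:E *
    (fun y : R => (expR y * y `^ (- q^-1) * \1_A (y `^ (- q^-1)))%R%:E)
      (`|V x|^-1 `^ q)%R))%E.
Proof.
move=> V_gt0 mA; rewrite /distribution /pushforward.
have mVA : measurable (V @^-1` A).
  by rewrite -[X in measurable X]setTI; exact: measurable_funPT.
rewrite -[X in P X]setIT -integral_indic//.
have mw := measurable_inv_norm V; have mY := measurable_inv_norm_powR q V.
have mr : measurable_fun [set: T] (fun x => `|V x|^-1 `^ q `^ (- q^-1)).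
  exact: (measurableT_comp (measurable_powR _)).
apply: ge0_ae_eq_integral => //.
- exact/measurable_EFinP.
- apply: emeasurable_funM; apply/measurable_EFinP.
    apply: measurable_funM => //; apply: (measurableT_comp (@measurable_expR R)).
    exact: measurableT_comp.
  apply: measurable_funM; last exact: measurableT_comp.
  apply: measurable_funM => //.
  exact: (measurableT_comp (@measurable_expR R)).
apply: filterS V_gt0 => x Vx _.
rewrite (gtr0_norm Vx) -powRrM mulrN mulfV ?gt_eqF// powR_inv1 ?invr_ge0 ?(ltW Vx)//.
rewrite invrK -EFinM indicE; congr EFin.
rewrite (_ : (x \in _)%:R = \1_A (V x) :> R); last first.
  by rewrite indicE; congr (_%:R); apply/idP/idP; rewrite !inE.
rewrite expRN; set e := expR _; have e0 : e != 0 by rewrite gt_eqF// expR_gt0.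
have v0 := lt0r_neq0 Vx; move: (V x) (\1_A _) v0 e e0 => v i v0 e e0.
by field; rewrite e0 v0.
Qed.

Lemma scale_factor_unique
    d1 (T1 : measurableType d1) (P1 : probability T1 R) (X1 V1 : {RV P1 >-> R})
    d2 (T2 : measurableType d2) (P2 : probability T2 R) (X2 V2 : {RV P2 >-> R}) :
  gen_normal q P1 X1 -> scale_factor P1 V1 X1 (pushforward Pp Xp) ->
  gen_normal q P2 X2 -> scale_factor P2 V2 X2 (pushforward Pp Xp) ->
  eq_law (distribution P1 V1) (distribution P2 V2).
Proof.
move=> X1_law VX1 X2_law VX2 A mA.
have [V1_gt0 _ _] := VX1; have [V2_gt0 _ _] := VX2.
rewrite !scale_factor_laplace_test//.
pose g (y : R) := (expR y * y `^ (- q^-1) * \1_A (y `^ (- q^-1)))%:E.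
apply: (@laplace_unique R _ T1 P1 (fun x => `|V1 x|^-1) (fun x => `|V1 x|^-1 `^ q)
  _ T2 P2 (fun x => `|V2 x|^-1) (fun x => `|V2 x|^-1 `^ q) (fun u =>
  gen_normal_cst p / gen_normal_cst q * expR (- ((2 * u) `^ (p / q) / 2)))
  _ _ _ _ _ _ _ _ _ _ g).
- exact: measurable_inv_norm.
- by move=> x; rewrite invr_ge0.
- exact: measurable_inv_norm_powR.
- by move=> x; exact: powR_ge0.
- exact: measurable_inv_norm.
- by move=> x; rewrite invr_ge0.
- exact: measurable_inv_norm_powR.
- by move=> x; exact: powR_ge0.
- exact: (mixture_laplace p0 q0 Xp_law X1_law VX1).
- exact: (mixture_laplace p0 q0 Xp_law X2_law VX2).
- apply/measurable_EFinP; apply: measurable_funM.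
    by apply: measurable_funM => //; exact: measurable_powR.
  by apply: measurableT_comp => //; exact: measurable_powR.
- by move=> y; rewrite lee_fin !mulr_ge0 ?expR_ge0 ?powR_ge0.
Qed.

End scale_factor_consequences.

(** * Existence of positive stable variables *)

(* For y >= 0 the exponential sums [expsum s] are the test functions; a function
   is [laplace_positive] when the functional sending [expsum s] to
   [lincomb s phi] is positive, as it is when [phi] is a Laplace transform. *)
Definition laplace_positive (R : realType) (phi : R -> R) : Prop :=
  forall s : seq (R * R), all (fun x => x.2 \in Num.nneg) s ->
  (forall y, 0 <= y -> 0 <= expsum s y) -> 0 <= lincomb s phi.

Section laplace_positive.
Context {R : realType}.
Implicit Types (phi psi : R -> R) (s : seq (R * R)) (c u v y : R).

Lemma eq_lincomb s phi psi : all (fun x => x.2 \in Num.nneg) s ->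
  (forall u, 0 <= u -> phi u = psi u) -> lincomb s phi = lincomb s psi.
Proof.
move=> /allP s0 phipsi; rewrite /lincomb big_seq [RHS]big_seq.
by apply: eq_bigr => x /s0; rewrite nnegrE => /phipsi ->.
Qed.

Lemma eq_laplace_positive phi psi : (forall u, 0 <= u -> phi u = psi u) ->
  laplace_positive phi -> laplace_positive psi.
Proof.
by move=> pp phi_pos s s0 se; rewrite -(eq_lincomb s0 pp); exact: phi_pos.
Qed.

(** This is the transform of c times the Dirac mass at 0: the functional evaluates the exponential
    sum at y = 0. *)
Lemma laplace_positive_cst c : 0 <= c -> laplace_positive (fun=> c).
Proof.
move=> c0 s _ /(_ 0 (lexx 0)); rewrite /expsum /lincomb.
under eq_bigr do rewrite mulr0 oppr0 expR0.
by move=> h; rewrite -mulr_suml mulr_ge0//; under eq_bigr do rewrite -[_.1]mulr1.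
Qed.

Lemma laplace_positiveD phi psi : laplace_positive phi -> laplace_positive psi ->
  laplace_positive (fun u => phi u + psi u).
Proof.
move=> phi_pos psi_pos s s0 se; rewrite /lincomb.
under eq_bigr do rewrite mulrDr.
by rewrite big_split addr_ge0//; [exact: phi_pos|exact: psi_pos].
Qed.

(** Convolution in terms of functionals: the one of [psi] acts on z in [expsum s (y + z)] for fixed
    y, which leaves a nonnegative exponential sum in y, and the one of [phi] acts on that. *)
Lemma laplace_positiveM phi psi : laplace_positive phi -> laplace_positive psi ->
  laplace_positive (fun u => phi u * psi u).
Proof.
move=> phi_pos psi_pos s s0 se.
pose t := [seq (x.1 * psi x.2, x.2) | x <- s].
have -> : lincomb s (fun u => phi u * psi u) = lincomb t phi.
  by rewrite /lincomb big_map; apply: eq_bigr => x _ /=; rewrite -mulrA (mulrC (phi _)).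
apply: phi_pos; first by rewrite all_map.
move=> y y0; pose r := [seq (x.1 * expR (- (x.2 * y)), x.2) | x <- s].
have -> : expsum t y = lincomb r psi.
  by rewrite /expsum /lincomb !big_map; apply: eq_bigr => x _ /=; rewrite mulrAC.
apply: psi_pos; first by rewrite all_map.
move=> z z0; have := se (y + z) (addr_ge0 y0 z0); congr (_ <= _).
rewrite /expsum /lincomb big_map; apply: eq_bigr => x _ /=.
by rewrite mulrDr opprD expRD mulrA.
Qed.

Lemma laplace_positiveZ c phi : 0 <= c -> laplace_positive phi ->
  laplace_positive (fun u => c * phi u).
Proof. by move=> c0; apply: laplace_positiveM; exact: laplace_positive_cst. Qed.

Lemma cvg_lincomb s (phi_ : nat -> R -> R) phi :
  all (fun x => x.2 \in Num.nneg) s ->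
  (forall u, 0 <= u -> phi_ n u @[n --> \oo] --> phi u) ->
  lincomb s (phi_ n) @[n --> \oo] --> lincomb s phi.
Proof.
move=> + cv; elim: s => [|x s ih] /=.
  move=> _; rewrite /lincomb; under eq_fun do rewrite big_nil.
  by rewrite big_nil; exact: cvg_cst.
move=> /andP[x0 s0]; rewrite lincomb_cons; under eq_fun do rewrite lincomb_cons.
apply: cvgD; last exact: ih.
by apply: cvgM; [exact: cvg_cst|apply: cv; rewrite -nnegrE].
Qed.

Lemma laplace_positive_lim (phi_ : nat -> R -> R) phi :
  (forall n, laplace_positive (phi_ n)) ->
  (forall u, 0 <= u -> phi_ n u @[n --> \oo] --> phi u) ->
  laplace_positive phi.
Proof.
move=> phi_pos cv s s0 se; have h := cvg_lincomb s0 cv.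
rewrite -(cvg_lim _ h)//; apply: limr_ge; first by apply/cvg_ex; eexists; exact: h.
by apply: nearW => n; exact: phi_pos.
Qed.

(** The partial sums of the exponential series are nonnegative combinations of powers. Up to
    normalization this builds a compound Poisson law. *)
Lemma laplace_positive_expR phi : laplace_positive phi ->
  laplace_positive (fun u => expR (phi u)).
Proof.
move=> phi_pos.
have pow n : laplace_positive (fun u => phi u ^+ n).
  elim: n => [|n ih].
    apply: (@eq_laplace_positive (fun=> 1)); last exact: laplace_positive_cst.
    by move=> u; rewrite expr0.
  apply: (@eq_laplace_positive (fun u => phi u * phi u ^+ n)).
    by move=> u; rewrite exprS.
  exact: laplace_positiveM.
apply: (@laplace_positive_lim (fun n u => series (exp_coeff (phi u)) n)).
  elim=> [|n ih].
    apply: (@eq_laplace_positive (fun=> 0)); last exact: laplace_positive_cst.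
    by move=> u _; rewrite /series/= big_geq.
  apply: (@eq_laplace_positive
      (fun u => series (exp_coeff (phi u)) n + n`!%:R^-1 * phi u ^+ n)).
    by move=> u _; rewrite /series/= big_nat_recr//= mulrC.
  by apply: laplace_positiveD => //; apply: laplace_positiveZ.
by move=> u _; exact: is_cvg_series_exp_coeff.
Qed.

Lemma laplace_positive_transform d (T : measurableType d)
    (mu : {measure set T -> \bar R}) (w Y : T -> R) phi :
  measurable_fun [set: T] w -> (forall x, 0 <= w x) ->
  measurable_fun [set: T] Y -> (forall x, 0 <= Y x) ->
  (forall u, u \in Num.nneg ->
    (\int[mu]_x (w x * expR (- (u * Y x)))%:E = (phi u)%:E)%E) ->
  laplace_positive phi.
Proof.
move=> mw w0 mY Y0 LE s s0 se.
rewrite -lee_fin -(integral_expsum mw w0 mY LE s0).2.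
by apply: integral_ge0 => x _; rewrite lee_fin mulr_ge0// se.
Qed.

End laplace_positive.

(** * The exponent u^alpha and the positivity of exp(- u^alpha) *)

Section stable_exponent.
Context {R : realType}.
Variable alpha : R.
Hypothesis alpha01 : 0 < alpha < 1.
Local Notation mu := (@lebesgue_measure R).

Lemma ge0_integral_oppr (f : R -> \bar R) : measurable_fun [set: R] f ->
  (forall x, (0 <= f x)%E) -> (\int[mu]_x f (- x)%R = \int[mu]_x f x)%E.
Proof.
move=> mf f0.
have mN : measurable_fun [set: measurableTypeR R]
    ((fun x => - x) : measurableTypeR R -> R) by exact: measurable_funN.
rewrite [RHS](@ge0_integral_weighted _ _ _ (measurableTypeR R) R mu (cst 1)
  (fun x : measurableTypeR R => - x) _ _ _ mN)//=.
- by apply: eq_integral => x _; rewrite mul1e.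
- move=> A mA; rewrite -[LHS](lebesgue_measureN mA) /pushforward -[X in mu X]setIT.
  rewrite -integral_indic//; first by apply: eq_integral => x _; rewrite mul1e.
  by rewrite -[X in measurable X]setTI; exact: mN.
Qed.

(** Under t = exp s, the stable jump measure t^(-alpha-1) dt becomes exp(- alpha s) ds on the whole
    line, and scaling t becomes a translation. [K] is the integrand at u = 1. *)
Let K (s : R) : R := (1 - expR (- expR s)) * expR (- (alpha * s)).

Let K_ge0 s : 0 <= K s.
Proof. by rewrite mulr_ge0 ?expR_ge0// subr_ge0 expR_le1 oppr_le0 expR_ge0. Qed.

Let measurable_K : measurable_fun [set: R] K.
Proof.
apply: measurable_funM.
  apply: measurable_funB => //; apply: (measurableT_comp (@measurable_expR R)).
  exact: measurableT_comp.
apply: (measurableT_comp (@measurable_expR R)); apply: measurableT_comp => //.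
Qed.

Let c : R := Num.min alpha (1 - alpha).

(** For s >= 0 the first factor of [K] is at most 1, which leaves the rate alpha; for s < 0 it is at
    most exp s, which leaves the rate 1 - alpha. [c] is the slower of the two, and exponential
    densities have known integrals. *)
Let K_bound s : K s <= c^-1 * (exponential_pdf c s + exponential_pdf c (- s)).
Proof.
have [a0 a1] := andP alpha01.
have c0 : 0 < c by rewrite lt_min a0 subr_gt0.
have ca : c <= alpha by rewrite ge_min lexx.
have c1a : c <= 1 - alpha by rewrite ge_min lexx orbT.
have pdfE x : 0 <= x -> exponential_pdf c x = c * expR (- c * x).
  by move=> x0; rewrite /exponential_pdf patchE mem_set//= in_itv/= x0.
have e1 : 0 <= 1 - expR (- expR s) by rewrite subr_ge0 expR_le1 oppr_le0 expR_ge0.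
have [s0|s0] := leP 0 s.
  apply: (@le_trans _ _ (c^-1 * exponential_pdf c s)); last first.
    by rewrite ler_wpM2l ?invr_ge0 ?(ltW c0)// lerDl exponential_pdf_ge0// ltW.
  rewrite pdfE// mulKf ?gt_eqF// -[leRHS]mul1r.
  by apply: ler_pM => //;
    rewrite ?ler_expR ?mulNr ?lerN2 ?ler_wpM2r ?gerBl ?expR_ge0.
apply: (@le_trans _ _ (c^-1 * exponential_pdf c (- s))); last first.
  by rewrite ler_wpM2l ?invr_ge0 ?(ltW c0)// lerDr exponential_pdf_ge0// ltW.
rewrite pdfE ?oppr_ge0 ?(ltW s0)// mulKf ?gt_eqF// mulrNN.
apply: (@le_trans _ _ (expR s * expR (- (alpha * s)))).
  rewrite ler_wpM2r ?expR_ge0// lerBlDr -lerBlDl.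
  by have := expR_ge1Dx (- expR s).
rewrite -expRD ler_expR; have : 0 <= (1 - alpha - c) * (- s).
  by rewrite mulr_ge0 ?subr_ge0// oppr_ge0 ltW.
lra.
Qed.

Lemma stable_exponent_fin : exists2 J : R, 0 < J & (\int[mu]_s (K s)%:E = J%:E)%E.
Proof.
have [a0 a1] := andP alpha01.
have c0 : 0 < c by rewrite lt_min a0 subr_gt0.
have mpdf : measurable_fun [set: R] (exponential_pdf c) by exact: measurable_exponential_pdf.
have pdf0 x : 0 <= exponential_pdf c x by rewrite exponential_pdf_ge0// ltW.
have Jfin : (\int[mu]_s (K s)%:E < +oo)%E.
  apply: (@le_lt_trans _ _ (\int[mu]_s (c^-1%:E *
      ((exponential_pdf c s)%:E + (exponential_pdf c (- s))%:E)))%E).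
    apply: ge0_le_integral => //.
    - by move=> s _; rewrite lee_fin.
    - exact/measurable_EFinP.
    - apply: emeasurable_funM => //; apply: emeasurable_funD.
        exact/measurable_EFinP.
      by apply/measurable_EFinP; apply: measurableT_comp.
    - by move=> s _; rewrite -EFinD -EFinM lee_fin; exact: K_bound.
  rewrite ge0_integralZl//; last 3 first.
  - apply: emeasurable_funD; first exact/measurable_EFinP.
    by apply/measurable_EFinP; apply: measurableT_comp.
  - by move=> s _; rewrite adde_ge0// lee_fin.
  - by rewrite lee_fin invr_ge0 ltW.
  rewrite ge0_integralD//; last 4 first.
  - by move=> s _; rewrite lee_fin.
  - exact/measurable_EFinP.
  - by move=> s _; rewrite lee_fin.
  - by apply/measurable_EFinP; apply: measurableT_comp.
  rewrite (ge0_integral_oppr (f := fun x => (exponential_pdf c x)%:E))//; last first.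
  - exact/measurable_EFinP.
  - by rewrite integral_exponential_pdf// -EFinD -EFinM ltry.
have J0 : (0 < \int[mu]_s (K s)%:E)%E.
  rewrite lt_def integral_ge0 ?andbT; last by move=> s _; rewrite lee_fin.
  apply/eqP => J0.
  have /(ae_eq_integral_abs mu measurableT) : (\int[mu]_s `|(K s)%:E| = 0)%E.
    by under eq_integral do rewrite gee0_abs ?lee_fin//.
  move=> /(_ _)K0.
  have : {ae mu, forall s, K s = 0}.
    have : ae_eq mu setT (fun s => (K s)%:E) (cst 0%E).
      by apply: K0; exact/measurable_EFinP.
    by apply: filterS => s /(_ I) [].
  move=> /ae_dense/(_ _ _ (@ltr01 R))[s _ /eqP]; apply/negP.
  by rewrite gt_eqF// mulr_gt0 ?expR_gt0// subr_gt0 expR_lt1 oppr_lt0 expR_gt0.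
move: J0 Jfin; case: (\int[mu]_s (K s)%:E)%E => // J J0 _.
by exists J.
Qed.

(* The translation s -> s + ln u multiplies the integral by u^alpha. *)
Lemma stable_exponent : exists2 J : R, 0 < J & forall u, 0 <= u ->
  (\int[mu]_s ((1 - expR (- (u * expR s))) * expR (- (alpha * s)))%:E =
   (J * u `^ alpha)%:E)%E.
Proof.
have [a0 a1] := andP alpha01; have [J J0 JE] := stable_exponent_fin.
exists J => // u; rewrite le_eqVlt => /predU1P[<-|u0].
  rewrite powR0 ?gt_eqF// mulr0; apply: integral0_eq => s _.
  by rewrite mul0r oppr0 expR0 subrr mul0r.
rewrite mulrC EFinM -JE [X in (_ * X)%E](ge0_integral_affine (ln u) ltr01); last 2 first.
- exact/measurable_EFinP.
- by move=> s; rewrite lee_fin.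
rewrite mul1e -ge0_integralZl//; last 3 first.
- apply/measurable_EFinP; apply: (measurableT_comp measurable_K).
  by apply: measurable_funD => //; exact: measurable_funM.
- by move=> s _; rewrite lee_fin.
- by rewrite lee_fin powR_ge0.
apply: eq_integral => s _; rewrite -EFinM; congr EFin.
rewrite /K mul1r expRD lnK ?posrE// (mulrC (expR s)).
have -> : expR (- (alpha * s)) = u `^ alpha * expR (- (alpha * (s + ln u))).
  by rewrite /powR gt_eqF// -expRD; congr expR; ring.
by rewrite mulrCA.
Qed.

(** The truncated jump measure is finite, so the integral of 1 - exp(- u t) splits into its mass
    [M n] minus its transform [g n u]; without truncation the mass is infinite. *)
Let w (n : nat) (s : R) : R := expR (- (alpha * s)) * \1_(`[- n%:R, n%:R] : set R) s.

Let w_ge0 n s : 0 <= w n s.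
Proof. by rewrite mulr_ge0 ?expR_ge0. Qed.

Let measurable_w n : measurable_fun [set: R] (w n).
Proof.
apply: measurable_funM; last exact: measurable_indic.
by apply: (measurableT_comp (@measurable_expR R)); apply: measurableT_comp.
Qed.

Let w_fin n : (\int[mu]_s (w n s)%:E < +oo)%E.
Proof.
have [a0 a1] := andP alpha01.
apply: (@le_lt_trans _ _ (\int[mu]_s ((expR (alpha * n%:R))%:E *
    (\1_(`[- n%:R, n%:R] : set R) s)%:E))%E).
  apply: ge0_le_integral; first exact: measurableT.
  - by move=> s _; rewrite lee_fin.
  - by apply/measurable_EFinP; exact: measurable_w.
  - by apply: emeasurable_funM => //; exact/measurable_EFinP.
  - move=> s _; rewrite -EFinM lee_fin /w indicE.
    have [|_] := boolP (s \in _); last by rewrite !mulr0.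
    rewrite inE /= in_itv/= => /andP[s1 _]; rewrite ler_wpM2r// ler_expR -mulrN.
    by rewrite ler_wpM2l ?(ltW a0)// lerNl.
rewrite ge0_integralZl//; last by apply/measurable_EFinP; exact: measurable_indic.
rewrite integral_indic// setIT.
rewrite [X in (_ * X < _)%E](lebesgue_measure_itv `[- n%:R, n%:R]%R)/=.
by case: ifP => _; rewrite ?mule0// -EFinB -EFinM ltry.
Qed.

Let mexp n u : measurable_fun [set: R] (fun s => w n s * expR (- (u * expR s))).
Proof.
apply: measurable_funM => //; apply: (measurableT_comp (@measurable_expR R)).
by apply: measurableT_comp => //; exact: measurable_funM.
Qed.

Let m1exp u : measurable_fun [set: R] (fun s : R => 1 - expR (- (u * expR s))).
Proof.
apply: measurable_funB => //; apply: (measurableT_comp (@measurable_expR R)).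
by apply: measurableT_comp => //; exact: measurable_funM.
Qed.

Let exp_le1 (u s : R) : 0 <= u -> 0 <= expR (- (u * expR s)) <= 1.
Proof. by move=> u0; rewrite expR_ge0 expR_le1 oppr_le0 mulr_ge0 ?expR_ge0. Qed.

Let g (n : nat) (u : R) : R :=
  fine (\int[mu]_s (w n s * expR (- (u * expR s)))%:E)%E.
Let M (n : nat) : R := fine (\int[mu]_s (w n s)%:E)%E.

Let gE n u : 0 <= u ->
  (\int[mu]_s (w n s * expR (- (u * expR s)))%:E = (g n u)%:E)%E.
Proof.
move=> u0; rewrite fineK// ge0_fin_numE; last first.
  by apply: integral_ge0 => s _; rewrite lee_fin mulr_ge0 ?expR_ge0.
apply: le_lt_trans (w_fin n); apply: ge0_le_integral; first exact: measurableT.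
- by move=> s _; rewrite lee_fin mulr_ge0 ?expR_ge0.
- by apply/measurable_EFinP; exact: mexp.
- by apply/measurable_EFinP; exact: measurable_w.
- by move=> s _; rewrite lee_fin ler_piMr//; case/andP: (exp_le1 s u0).
Qed.

Let laplace_positive_g n : laplace_positive (g n).
Proof.
apply: (@laplace_positive_transform _ _ (measurableTypeR R) mu (w n) expR) => //.
- exact: measurable_w.
- by move=> u; rewrite nnegrE; exact: gE.
Qed.

Let exponentE n u : 0 <= u ->
  (\int[mu]_s (w n s * (1 - expR (- (u * expR s))))%:E = (M n - g n u)%:E)%E.
Proof.
move=> u0.
have ME : ((M n)%:E = \int[mu]_s (w n s)%:E)%E.
  by rewrite fineK// ge0_fin_numE//; apply: integral_ge0 => s _; rewrite lee_fin.
have : (\int[mu]_s (w n s * (1 - expR (- (u * expR s))))%:E + (g n u)%:E =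
    (M n)%:E)%E.
  rewrite -gE// -ge0_integralD//; last 4 first.
  - move=> s _; rewrite lee_fin mulr_ge0// subr_ge0.
    by case/andP: (exp_le1 s u0).
  - apply/measurable_EFinP; apply: measurable_funM.
      exact: measurable_w.
    exact: m1exp.
  - by move=> s _; rewrite lee_fin mulr_ge0 ?expR_ge0.
  - by apply/measurable_EFinP; exact: mexp.
  rewrite ME; apply: eq_integral => s _; rewrite -EFinD; congr EFin.
  by rewrite -mulrDr subrK mulr1.
case: (\int[mu]_s _)%E => [r [<-]|//|//].
by rewrite addrK.
Qed.

(** For each n, exp(- (M n - g n u) / J) is a compound Poisson transform: a positive constant times
    the exponential of a positive functional. Monotone convergence sends M n - g n u to J
    u^alpha. *)
Lemma exp_powR_laplace_positive : laplace_positive (fun u => expR (- (u `^ alpha))).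
Proof.
have [J J0 JE] := stable_exponent.
apply: (@laplace_positive_lim _
  (fun n u => expR (- (J^-1 * M n)) * expR (J^-1 * g n u))).
  move=> n; apply: laplace_positiveZ; first exact: expR_ge0.
  apply: laplace_positive_expR; apply: laplace_positiveZ => //.
  by rewrite invr_ge0 ltW.
move=> u u0.
have cv : M n - g n u @[n --> \oo] --> J * u `^ alpha.
  have : (\int[mu]_s (w n s * (1 - expR (- (u * expR s))))%:E @[n --> \oo] -->
      \int[mu]_s ((1 - expR (- (u * expR s))) * expR (- (alpha * s)))%:E)%E.
    have wcvg s : (w n s * (1 - expR (- (u * expR s))))%:E @[n --> \oo] -->
        ((1 - expR (- (u * expR s))) * expR (- (alpha * s)))%:E.
      apply: cvg_near_cst; exists (Num.bound `|s|) => // n /= sn.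
      congr EFin; rewrite mulrC /w indicE mem_set ?mulr1//= in_itv/= -ler_norml.
      by rewrite (le_trans (ltW (archi_boundP (normr_ge0 s))))// ler_nat.
    rewrite (_ : \int[mu]_s _ = \int[mu]_s
        limn (fun n => (w n s * (1 - expR (- (u * expR s))))%:E))%E; last first.
      by apply: eq_integral => s _; apply/esym/cvg_lim => //; exact: wcvg.
    apply: cvg_monotone_convergence => //.
    - move=> n; apply/measurable_EFinP; apply: measurable_funM.
        exact: measurable_w.
      exact: m1exp.
    - move=> n s _; rewrite lee_fin mulr_ge0// subr_ge0.
      by case/andP: (exp_le1 s u0).
    - move=> s _ m n mn; rewrite lee_fin ler_wpM2r//.
        by rewrite subr_ge0; case/andP: (exp_le1 s u0).
      rewrite ler_wpM2l ?expR_ge0// !indicE ler_nat.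
      have [|//] := boolP (s \in `[- m%:R, m%:R]%classic).
      rewrite inE/= in_itv/= => /andP[s1 s2]; rewrite mem_set//= in_itv/=.
      have mnR : (m%:R <= n%:R :> R) by rewrite ler_nat.
      by rewrite (le_trans _ s1) ?lerN2// (le_trans s2).
  rewrite JE//; under eq_fun do rewrite exponentE//.
  by move/fine_cvg; exact.
under eq_fun do rewrite -expRD.
have cvE : - (J^-1 * M n) + J^-1 * g n u @[n --> \oo] --> - (u `^ alpha).
  have -> : - (u `^ alpha) = - (J^-1 * (J * u `^ alpha)) by rewrite mulKf ?gt_eqF.
  rewrite [X in X @ _](_ : _ = fun n => - (J^-1 * (M n - g n u))).
    by apply: cvgN; apply: cvgM; [exact: cvg_cst|exact: cv].
  by apply/funext => n; ring.
apply: (cvg_comp _ expR cvE); exact: continuous_expR.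
Qed.

End stable_exponent.

(** * Exponential sums that majorize the indicator of [0, x] *)

Section step_majorant.
Context {R : realType}.
Implicit Types (s : seq (R * R)) (c e u v x y : R).

Lemma continuous_expsum s : continuous (expsum s).
Proof.
elim: s => [|[c u] s ih] y.
  rewrite (_ : expsum _ = cst 0); first exact: cvg_cst.
  by apply/funext => z; rewrite /expsum /lincomb big_nil.
rewrite (_ : expsum _ = fun z => c * expR (- (u * z)) + expsum s z); last first.
  by apply/funext => z; rewrite /expsum lincomb_cons.
apply: cvgD; last exact: ih.
apply: cvgM; first exact: cvg_cst.
apply: (continuous_comp (f := fun z => - (u * z))); last exact: continuous_expR.
by apply: cvgN; apply: cvgM; [exact: cvg_cst|exact: cvg_id].
Qed.

Definition majorant x s := [/\ all (fun z => z.2 \in Num.nneg) s,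
  forall y, 0 <= y -> 0 <= expsum s y &
  forall y, 0 <= y <= x -> 1 <= expsum s y].

Lemma expsum1 c u y : expsum [:: (c, u)] y = c * expR (- (u * y)).
Proof. exact: lincomb1. Qed.

Lemma expsum_cat s t y : expsum (s ++ t) y = expsum s y + expsum t y.
Proof. exact: lincomb_cat. Qed.

Lemma majorant1 x : majorant x [:: (1, 0)].
Proof.
by split=> [|y _|y _]; rewrite ?expsum1 ?mul0r ?oppr0 ?expR0 ?mulr1//= nnegrE lexx.
Qed.

(** Take 1 + e/2 - k with k a step kernel for x. As k increases in y, k(x) <= e/2 and k(z) >= 1 -
    e/2 control it on [0, x] and beyond z, so pointwise convergence at two points suffices. *)
Lemma sharp_majorant x z e : 0 <= x -> x < z -> 0 < e ->
  exists2 s, majorant x s & forall y, 0 <= y -> expsum s y <= (y < z)%R%:R + e.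
Proof.
move=> x0 xz e0; have [v [N [v0 vN]]] := step_kernel x0.
pose d := e / 2; have d0 : 0 < d by rewrite divr_gt0.
have z0 : 0 <= z by rewrite (le_trans x0)// ltW.
have /cvgrPdist_lt/(_ _ d0) Nx := vN _ x0.
have /cvgrPdist_lt/(_ _ d0) Nz := vN _ z0.
have [n [nx nz]] := filter_ex (filterI Nx Nz); move: nx nz => /=.
rewrite ltxx xz sub0r normrN => nx nz.
pose k y := (1 - expR (- (v n * y))) ^+ N n.
have e01 y : 0 <= y -> 0 <= 1 - expR (- (v n * y)) <= 1.
  by move=> y0; rewrite subr_ge0 gerBl expR_ge0 expR_le1 oppr_le0 mulr_ge0.
have k01 y : 0 <= y -> 0 <= k y <= 1.
  by move=> /e01/andP[? ?]; rewrite exprn_ge0// exprn_ile1.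
have kmono y y' : 0 <= y -> y <= y' -> k y <= k y'.
  move=> y0 yy; rewrite /k lerXn2r// ?nnegrE; last 3 first.
  - by case/andP: (e01 _ y0).
  - by case/andP: (e01 _ (le_trans y0 yy)).
  by rewrite lerB// ler_expR lerN2 ler_wpM2l.
have kx : k x <= d by rewrite (le_trans (ler_norm _))// ltW.
have kz : 1 - d <= k z.
  by rewrite lerBlDr -lerBlDl (le_trans (ler_norm _))// ltW.
pose t := iter (N n) (mul_onem_exp (v n)) [:: (1, 0)].
have t_nneg : all (fun z => z.2 \in Num.nneg) t.
  apply: all_mul_onem; last by rewrite /= nnegrE lexx.
  by move=> u; rewrite !nnegrE => u0; rewrite addr_ge0.
have tE y : expsum t y = k y.
  by rewrite expsum_mul_onem expsum1 mul0r oppr0 expR0 !mulr1.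
pose s := [:: (1 + d, 0)] ++ [seq (-1 * z.1, z.2 + 0) | z <- t].
have sE y : expsum s y = 1 + d - k y.
  rewrite expsum_cat expsum1 mul0r oppr0 expR0 mulr1 /expsum lincomb_map.
  by rewrite lincomb_shift_exp mul0r oppr0 expR0 mul1r tE mulN1r.
exists s.
  split.
  - rewrite all_cat /= nnegrE lexx/= all_map; apply: sub_all t_nneg => w /=.
    by rewrite addr0.
  - move=> y /k01/andP[_ k1]; rewrite sE; lra.
  - move=> y /andP[y0 yx]; rewrite sE; have := kmono _ _ y0 yx; lra.
move=> y y0; rewrite sE; have /andP[ky0 ky1] := k01 _ y0.
have de : e = d + d by rewrite /d; field.
have [yz|zy] := ltP y z; first by rewrite de mulr1n; lra.
by have := kmono _ _ z0 zy; rewrite de mulr0n; lra.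
Qed.

End step_majorant.

(** * The distribution function defined by majorants *)

Section majorant_cdf.
Context {R : realType}.
Variable phi : R -> R.
Hypotheses (phi_pos : laplace_positive phi) (phi0 : phi 0 = 1).
Implicit Types (s : seq (R * R)) (c e u v x y : R).

Definition majorant_cdf x : R := inf [set lincomb s phi | s in majorant x].

Local Notation G := majorant_cdf.

Lemma majorant_lincomb_ge0 x s : majorant x s -> 0 <= lincomb s phi.
Proof. by case=> *; exact: phi_pos. Qed.

Let has_lb x : has_lbound [set lincomb s phi | s in majorant x].
Proof. by exists 0 => _ [s xs <-]; exact: majorant_lincomb_ge0 xs. Qed.

Let nonempty x : [set lincomb s phi | s in majorant x] !=set0.
Proof. by exists (lincomb [:: (1, 0)] phi), [:: (1, 0)] => //; exact: majorant1. Qed.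

Lemma majorant_cdf_le x s : majorant x s -> G x <= lincomb s phi.
Proof. by move=> xs; apply: ge_inf => //; exists s. Qed.

Lemma majorant_cdf_ge x c :
  (forall s, majorant x s -> c <= lincomb s phi) -> c <= G x.
Proof. by move=> h; apply: lb_le_inf => // _ [s xs <-]; exact: h. Qed.

Lemma majorant_cdf_adherent x e : 0 < e ->
  exists2 s, majorant x s & lincomb s phi <= G x + e.
Proof.
move=> e0.
have [|_ [s xs <-] h] :=
    @inf_adherent _ [set lincomb s phi | s in majorant x] _ e0.
  by split.
by exists s => //; exact: ltW.
Qed.

Lemma majorant_cdf_ge0 x : 0 <= G x.
Proof. by apply: majorant_cdf_ge => s; exact: majorant_lincomb_ge0. Qed.

Lemma majorant_cdf_le1 x : G x <= 1.
Proof. by have := majorant_cdf_le (majorant1 x); rewrite lincomb1 phi0 mulr1. Qed.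

Lemma majorant_cdf_lt0 x : x < 0 -> G x = 0.
Proof.
move=> x0; apply/eqP; rewrite eq_le majorant_cdf_ge0 andbT.
have := @majorant_cdf_le x [::]; rewrite /lincomb big_nil; apply; split => //.
  by move=> y _; rewrite /expsum /lincomb big_nil.
by move=> y /andP[y0 yx]; have := le_lt_trans y0 (le_lt_trans yx x0); rewrite ltxx.
Qed.

Lemma majorant_cdf_nd : nondecreasing_fun G.
Proof.
move=> x y xy; apply: majorant_cdf_ge => s [s1 s2 s3].
apply: majorant_cdf_le; split => // z /andP[z0 zx].
by apply: s3; rewrite z0 (le_trans zx).
Qed.

(** A majorant at x within h = e/2 of the infimum, raised by the constant h, stays above 1 slightly
    to the right of x by continuity; raising it costs h, since [phi 0 = 1]. *)
Lemma majorant_cdf_right x e : 0 < e ->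
  exists2 d, 0 < d & forall y, x < y -> y < x + d -> G y <= G x + e.
Proof.
move=> e0; have [x0|x0] := ltP x 0.
  exists (- x); first by rewrite oppr_gt0.
  move=> y _; rewrite subrr => y0; rewrite (majorant_cdf_lt0 y0).
  by rewrite addr_ge0 ?majorant_cdf_ge0 ?ltW.
pose h := e / 2; have h0 : 0 < h by rewrite divr_gt0.
have [s [s1 s2 s3] sG] := @majorant_cdf_adherent x _ h0.
have /cvgrPdist_lt/(_ _ h0)/nbhs_ballP[d /= d0 sd] := @continuous_expsum _ s x.
exists d => // y xy yd.
have : G y <= lincomb (s ++ [:: (h, 0)]) phi.
  apply: majorant_cdf_le; split.
  - by rewrite all_cat s1/= nnegrE lexx.
  - move=> z z0; rewrite expsum_cat expsum1 mul0r oppr0 expR0 mulr1.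
    by rewrite addr_ge0 ?s2// ltW.
  - move=> z /andP[z0 zy]; rewrite expsum_cat expsum1 mul0r oppr0 expR0 mulr1.
    have [zx|xz] := leP z x.
      by have := s3 z; rewrite z0 zx => /(_ isT); lra.
    have : `|expsum s x - expsum s z| < h.
      apply: sd; rewrite /ball/= ltr_norml; apply/andP; split; lra.
    rewrite ltr_norml => /andP[_]; have := s3 x; rewrite x0 lexx => /(_ isT).
    lra.
rewrite lincomb_cat lincomb1 phi0 mulr1 => /le_trans; apply.
by have -> : G x + e = G x + h + h by [rewrite /h; field]; rewrite lerD2r.
Qed.

(** The function exp(- u y) - exp(- u x) lies below the indicator of [0, x], hence below every
    majorant. This bound drives G to 1 at infinity. *)
Lemma majorant_cdf_lower x u : 0 <= u -> 0 <= x -> phi u - expR (- (u * x)) <= G x.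
Proof.
move=> u0 x0; apply: majorant_cdf_ge => s [s1 s2 s3].
have : 0 <= lincomb (s ++ [:: (-1, u); (expR (- (u * x)), 0)]) phi.
  apply: phi_pos.
    by rewrite all_cat s1/= !nnegrE u0 lexx.
  move=> y y0; rewrite expsum_cat {2}/expsum lincomb_cons lincomb1/=.
  rewrite mul0r oppr0 expR0 mulr1 mulN1r.
  have [yx|xy] := leP y x.
    have := s3 y; rewrite y0 yx => /(_ isT).
    have : expR (- (u * y)) <= 1 by rewrite expR_le1 oppr_le0 mulr_ge0.
    have := expR_ge0 (- (u * x)); lra.
  have := s2 y y0.
  have : expR (- (u * y)) <= expR (- (u * x)).
    by rewrite ler_expR lerN2 ler_wpM2l// ltW.
  lra.
rewrite lincomb_cat lincomb_cons lincomb1/= phi0; lra.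
Qed.

Lemma sum_majorant_upper (k : nat) (x_ : nat -> R) e : 0 < e ->
  exists s, [/\ all (fun z => z.2 \in Num.nneg) s,
    forall y, 0 <= y -> \sum_(j < k) (y <= x_ j)%R%:R <= expsum s y &
    lincomb s phi <= \sum_(j < k) (G (x_ j) + e)].
Proof.
move=> e0; elim: k => [|k [s [s1 s2 s3]]].
  by exists [::]; split=> [//|y _|]; rewrite /expsum /lincomb ?big_nil big_ord0.
have [t [t1 t2 t3] tG] := @majorant_cdf_adherent (x_ k) _ e0.
exists (s ++ t); split.
- by rewrite all_cat s1.
- move=> y y0; rewrite big_ord_recr/= expsum_cat lerD ?s2//.
  by case: (leP y (x_ k)) => yx; [rewrite t3// y0|exact: t2].
- by rewrite lincomb_cat big_ord_recr/= lerD.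
Qed.

(** A majorant of [0, x_ j] cannot be bounded by the indicator itself, so each [sharp_majorant] is
    allowed the room up to [z_ j] and an error e. *)
Lemma sum_majorant_lower (k : nat) (x_ z_ : nat -> R) e : 0 < e ->
  (forall j, (j < k)%N -> 0 <= x_ j /\ x_ j < z_ j) ->
  exists s, [/\ all (fun z => z.2 \in Num.nneg) s,
    forall y, 0 <= y -> expsum s y <= \sum_(j < k) ((y < z_ j)%R%:R + e) &
    \sum_(j < k) G (x_ j) <= lincomb s phi].
Proof.
move=> e0; elim: k => [|k ih] xz.
  by exists [::]; split=> [//|y _|]; rewrite /expsum /lincomb ?big_nil big_ord0.
have [s [s1 s2 s3]] := ih (fun j jk => xz j (ltnW jk)).
have [x0 xzk] := xz k (ltnSn k).
have [t tx tz] := sharp_majorant x0 xzk e0.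
exists (s ++ t); split.
- by rewrite all_cat s1; case: tx.
- by move=> y y0; rewrite big_ord_recr/= expsum_cat lerD ?s2// tz.
- by rewrite lincomb_cat big_ord_recr/= lerD// majorant_cdf_le.
Qed.

End majorant_cdf.

(** * Level sums of a decreasing exponential *)

Section levels.
Context {R : realType}.
Implicit Types (t u y : R) (m j k : nat).

(** The sum is the minimum of m and the integer part of t. This and the next bound, at t = m exp(- u
    y), give the layer-cake approximation. *)
Lemma sum_levels_le m t : 0 <= t -> \sum_(j < m) (j.+1%:R <= t)%R%:R <= t.
Proof.
move=> t0; elim: m => [|m ih]; first by rewrite big_ord0.
rewrite big_ord_recr/=; have [mt|_] := leP m.+1%:R t; last by rewrite addr0.
apply: le_trans mt; rewrite -natr1 lerD2r.
apply: (@le_trans _ _ (\sum_(j < m) 1)); last by rewrite sumr_const card_ord.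
by apply: ler_sum => j _; rewrite lern1 leq_b1.
Qed.

Lemma sum_levels_ge m t : t <= m%:R -> t <= \sum_(j < m) (j.+1%:R <= t)%R%:R + 1.
Proof.
elim: m => [|m ih tm]; first by rewrite big_ord0 add0r => /le_trans; apply.
rewrite big_ord_recr/=; have [/ih|mt] := leP t m%:R.
  by move=> /le_trans; apply; rewrite lerD2r lerDl.
apply: (le_trans tm); rewrite -natr1 lerD2r.
apply: (@le_trans _ _ (\sum_(j < m) 1)); first by rewrite sumr_const card_ord.
rewrite -[leLHS]addr0 lerD//.
apply: ler_sum => j _; suff -> : (j.+1%:R <= t)%R by [].
by rewrite (le_trans _ (ltW mt))// ler_nat.
Qed.

(* [level u m j] is the point at which exp(- u y) takes the value (j + 1) / m. *)
Definition level u m j : R := ln (m%:R / j.+1%:R) / u.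

Lemma level_le u m j y : 0 < u -> (0 < m)%N ->
  (y <= level u m j) = (j.+1%:R <= m%:R * expR (- (u * y))).
Proof.
move=> u0 m0; rewrite /level ler_pdivlMr// -ler_expR lnK; last first.
  by rewrite posrE divr_gt0// ltr0n.
by rewrite expRN ler_pdivlMr// ler_pdivlMr ?expR_gt0// mulrC (mulrC y).
Qed.

Lemma level_ge0 u m j : 0 < u -> (j < m)%N -> 0 <= level u m j.
Proof.
move=> u0 jm; rewrite level_le//; last exact: leq_ltn_trans jm.
by rewrite mulr0 oppr0 expR0 mulr1 ler_nat.
Qed.

Lemma level_lt u m j : 0 < u -> (0 < m)%N -> level u m j.+1 < level u m j.
Proof.
move=> u0 m0; rewrite ltr_pM2r ?invr_gt0// ltr_ln ?posrE ?divr_gt0 ?ltr0n//.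
by rewrite ltr_pM2l ?ltr0n// ltf_pV2 ?posrE ?ltr0n// ltr_nat.
Qed.

End levels.

(** * Bernstein's theorem: a positive functional is a Laplace transform *)

Section bernstein.
Context {R : realType}.
Variable phi : R -> R.
Hypotheses (phi_pos : laplace_positive phi) (phi0 : phi 0 = 1).
Local Notation G := (majorant_cdf phi).

Lemma laplace_positive_le (s t : seq (R * R)) :
  all (fun z => z.2 \in Num.nneg) s -> all (fun z => z.2 \in Num.nneg) t ->
  (forall y, 0 <= y -> expsum s y <= expsum t y) ->
  lincomb s phi <= lincomb t phi.
Proof.
move=> s0 t0 st; pose r := t ++ [seq (-1 * z.1, z.2 + 0) | z <- s].
have rE psi : lincomb r psi = lincomb t psi - lincomb s psi.
  rewrite lincomb_cat lincomb_map mulN1r; congr (_ - _).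
  by apply: eq_bigr => z _; rewrite addr0.
rewrite -subr_ge0 -rE; apply: phi_pos.
  by rewrite all_cat t0 all_map/=; apply: sub_all s0 => z /=; rewrite addr0.
by move=> y y0; rewrite /expsum rE subr_ge0; exact: st.
Qed.

(** The functional is applied to the layer-cake bound for (m + 1) exp(- u y). Of the 2, one unit is
    the rounding to integers and one the sum of the m + 1 errors 1 / (m + 1). *)
Lemma sum_level_cdf_ge (u : R) (m : nat) : 0 < u ->
  m.+1%:R * phi u <= \sum_(j < m.+1) G (level u m.+1 j) + 2.
Proof.
move=> u0; have m0 : 0 < m.+1%:R :> R by rewrite ltr0n.
have e0 : 0 < m.+1%:R^-1 :> R by rewrite invr_gt0.
have [s [s1 s2 s3]] := sum_majorant_upper phi_pos m.+1 (level u m.+1) e0.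
rewrite -[leLHS]lincomb1; apply: (@le_trans _ _ (lincomb (s ++ [:: (1, 0)]) phi)).
  apply: laplace_positive_le.
  - by rewrite /= nnegrE ltW.
  - by rewrite all_cat s1 /= nnegrE lexx.
  - move=> y y0; rewrite expsum_cat !expsum1 mul0r oppr0 expR0 mulr1.
    apply: (@le_trans _ _ (\sum_(j < m.+1) (y <= level u m.+1 j)%R%:R + 1)); last first.
      by rewrite lerD2r s2.
    under eq_bigr do rewrite level_le//.
    apply: sum_levels_ge; rewrite ler_piMr ?(ltW m0)// expR_le1 oppr_le0.
    by rewrite mulr_ge0// ltW.
rewrite lincomb_cat lincomb1 phi0 mulr1.
have : \sum_(j < m.+1) (G (level u m.+1 j) + m.+1%:R^-1) =
    \sum_(j < m.+1) G (level u m.+1 j) + 1.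
  rewrite big_split/=; congr (_ + _).
  by rewrite sumr_const card_ord -[LHS]mulr_natl mulfV// gt_eqF.
by move: s3 => + E; rewrite E; lra.
Qed.

(** Each sharp majorant spills over to the next larger level, which shifts the index by one. The
    term j = 0 is left alone and is at most 1; the m errors 1 / (m + 1) add at most 1 more. *)
Lemma sum_level_cdf_le (u : R) (m : nat) : 0 < u ->
  \sum_(j < m.+1) G (level u m.+1 j) <= m.+1%:R * phi u + 2.
Proof.
move=> u0; have m0 : 0 < m.+1%:R :> R by rewrite ltr0n.
have e0 : 0 < m.+1%:R^-1 :> R by rewrite invr_gt0.
have [|s [s1 s2 s3]] := sum_majorant_lower phi_pos
  (k := m) (x_ := fun j => level u m.+1 j.+1) (z_ := level u m.+1) e0.
  by move=> j jm; split; [exact: level_ge0|exact: level_lt].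
rewrite big_ord_recl/=; have G0 := majorant_cdf_le1 phi_pos phi0 (level u m.+1 0).
have : lincomb s phi <= lincomb [:: (m.+1%:R, u); (1, 0)] phi.
  apply: laplace_positive_le => //.
    by rewrite /= !nnegrE ltW//= lexx.
  move=> y y0; apply: (le_trans (s2 y y0)).
  rewrite [leRHS]lincomb_cons lincomb1/= mul0r oppr0 expR0 mulr1.
  rewrite big_split/= lerD//.
    apply: (@le_trans _ _ (\sum_(j < m.+1)
        (j.+1%:R <= m.+1%:R * expR (- (u * y)))%R%:R)).
      rewrite [leRHS]big_ord_recr/= -[leLHS]addr0 lerD//.
      apply: ler_sum => j _; rewrite -level_le// ler_nat.
      by case: ltP => // /ltW ->.
    by apply: sum_levels_le; rewrite mulr_ge0 ?expR_ge0// ltW.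
  rewrite sumr_const card_ord -[leLHS]mulr_natl ler_pdivrMr// mul1r ler_nat.
  exact: leqnSn.
rewrite lincomb_cons lincomb1/= phi0; move: s3; rewrite /bump/=.
lra.
Qed.

(** Values near 1 prevent mass from escaping to infinity; the small values in the next hypothesis
    exclude an atom at 0. *)
Hypothesis phi_right : forall e, 0 < e -> exists2 u, 0 < u & 1 - e < phi u.
Hypothesis phi_infty : forall e, 0 < e -> exists2 u, 0 < u & phi u < e.

Lemma majorant_cdf_right_continuous : right_continuous G.
Proof.
move=> x; apply/cvgrPdist_le => e e0.
have [d d0 dG] := majorant_cdf_right phi_pos phi0 x e0.
near=> y; have xy : x < y by near: y; exact: nbhs_right_gt.
have yd : y < x + d by near: y; apply: nbhs_right_lt; rewrite ltrDl.
have := majorant_cdf_nd phi_pos (ltW xy); have := dG y xy yd => h1 h2.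
rewrite ler_norml; apply/andP; split; lra.
Unshelve. all: by end_near. Qed.

Lemma majorant_cdfNy : G @ -oo --> (0 : R).
Proof.
apply: cvg_near_cst; near=> x.
have x0 : x < 0 by near: x; exact: nbhs_ninfty_lt.
exact: majorant_cdf_lt0.
Unshelve. all: by end_near. Qed.

Lemma majorant_cdfy : G @ +oo --> (1 : R).
Proof.
apply/cvgrPdist_le => e e0; have h0 : 0 < e / 2 by rewrite divr_gt0.
have [u u0 ue] := phi_right h0.
near=> x; have x0 : 0 < x by near: x; exact: nbhs_pinfty_gt.
(* Beyond this threshold, exp(- u x) <= 1 / (1 + u x) <= e / 2. *)
have xe : 2 / (e * u) < x.
  by near: x; apply: nbhs_pinfty_gt; exact: num_real.
have : expR (- (u * x)) <= e / 2.
  rewrite expRN -[leRHS]invrK lef_pV2 ?posrE ?expR_gt0 ?invr_gt0//.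
  apply: le_trans (expR_ge1Dx _); rewrite invf_div ler_wpDl//.
  move: xe; rewrite ltr_pdivrMr ?mulr_gt0// => xe.
  rewrite ler_pdivrMr//; lra.
have := majorant_cdf_lower phi_pos phi0 (ltW u0) (ltW x0).
have := majorant_cdf_le1 phi_pos phi0 x => h1 h2 h3.
rewrite ler_norml; apply/andP; split; lra.
Unshelve. all: by end_near. Qed.

Lemma majorant_cdf_probability : exists P : probability (measurableTypeR R) R,
  forall x, P `]-oo, x]%classic = (G x)%:E.
Proof.
have nd : nondecreasing G := majorant_cdf_nd phi_pos.
pose C := isCumulative.Build R _ R G nd majorant_cdf_right_continuous.
pose B := isCumulativeBounded.Build R 0 1 G majorant_cdfNy majorant_cdfy.
pose F : cumulativeBounded (0 : R) (1 : R) := HB.pack G C B.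
exists (lebesgue_stieltjes_measure F) => x.
by have := cdf_lebesgue_stieltjes_id F x.
Qed.

(** The single exponential exp(- u y) is a majorant at x = 0, so G 0 <= phi u for every u > 0. *)
Lemma majorant_cdf0 : G 0 = 0.
Proof.
apply/eqP; rewrite eq_le majorant_cdf_ge0// andbT; apply/ler_addgt0Pr => e e0.
have [u u0 ue] := phi_infty e0; rewrite add0r; apply: le_trans (ltW ue).
rewrite -[leRHS]mul1r -lincomb1; apply: majorant_cdf_le => //; split.
- by rewrite /= nnegrE ltW.
- by move=> y _; rewrite expsum1 mul1r expR_ge0.
- move=> y; rewrite andbC -eq_le => /eqP ->.
  by rewrite expsum1 mulr0 oppr0 expR0 mulr1.
Qed.

(** With M = m + 1, M times the expectation is within 1 of the level sum and M phi u is within 2 of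
    it, so the two differ by at most 3 / M. Replacing y by max y 0 makes the variable nonnegative
    everywhere; as levels are nonnegative, it does not change which of them lie above y. *)
Lemma majorant_cdf_laplace (P : probability (measurableTypeR R) R) :
  (forall x, P `]-oo, x]%classic = (G x)%:E) ->
  forall u, 0 < u -> (\int[P]_y (expR (- (u * Num.max y 0)))%:E = (phi u)%:E)%E.
Proof.
move=> PG u u0; pose S (y : R) := Num.max y 0; pose f y := expR (- (u * S y)).
have mS : measurable_fun [set: measurableTypeR R] S.
  exact: (measurable_maxr (@measurable_id _ _ _) (measurable_cst _)).
have mf : measurable_fun [set: measurableTypeR R] f.
  apply: (measurableT_comp (@measurable_expR R)); apply: measurableT_comp => //.
  exact: measurable_funM.
have S0 y : 0 <= S y by rewrite le_max lexx orbT.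
have f0 y : 0 <= f y by exact: expR_ge0.
have f1 y : f y <= 1 by rewrite expR_le1 oppr_le0 mulr_ge0// ltW.
pose h m y := \sum_(j < m.+1) \1_(`]-oo, level u m.+1 j] : set R) y : R.
have hE m y : h m y = \sum_(j < m.+1) (j.+1%:R <= m.+1%:R * f y)%R%:R.
  apply: eq_bigr => j _; rewrite -level_le// indicE; congr (nat_of_bool _)%:R.
  rewrite /S ge_max level_ge0// andbT.
  by apply/idP/idP; rewrite inE/= in_itv.
have h0 m y : 0 <= h m y by apply: sumr_ge0 => j _.
have mh m : measurable_fun [set: measurableTypeR R] (h m).
  by apply: measurable_sum => j; exact: measurable_indic.
have Ih m : (\int[P]_y (h m y)%:E = (\sum_(j < m.+1) G (level u m.+1 j))%:E)%E.
  rewrite -sumEFin; under eq_integral do rewrite -sumEFin.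
  rewrite ge0_integral_sum//; last first.
    by move=> j; apply/measurable_EFinP; exact: measurable_indic.
  by apply: eq_bigr => j _; rewrite integral_indic// setIT; exact: PG.
have [i iE] : exists i, (\int[P]_y (f y)%:E = i%:E)%E.
  have : (\int[P]_y (f y)%:E <= 1)%E.
    rewrite -(probability_setT P) -[leRHS]mul1e -integral_cst//.
    apply: ge0_le_integral; first exact: measurableT.
    - by move=> y _; rewrite lee_fin.
    - exact/measurable_EFinP.
    - exact: measurable_cst.
    - by move=> y _; rewrite lee_fin.
  have : (0 <= \int[P]_y (f y)%:E)%E by apply: integral_ge0 => y _; rewrite lee_fin.
  by case: (\int[P]_y _)%E => // r _ _; exists r.
have If m : (\int[P]_y (m.+1%:R * f y)%:E = (m.+1%:R * i)%:E)%E.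
  under eq_integral do rewrite EFinM.
  rewrite ge0_integralZl; [by rewrite iE|exact: measurableT| | |by rewrite lee_fin].
    exact/measurable_EFinP.
  by move=> y _; rewrite lee_fin.
have mMf m : measurable_fun [set: measurableTypeR R] (fun y => m.+1%:R * f y).
  exact: measurable_funM.
have lower m : \sum_(j < m.+1) G (level u m.+1 j) <= m.+1%:R * i.
  rewrite -lee_fin -Ih -If; apply: ge0_le_integral; first exact: measurableT.
  - by move=> y _; rewrite lee_fin.
  - exact/measurable_EFinP.
  - exact/measurable_EFinP.
  - by move=> y _; rewrite lee_fin hE sum_levels_le// mulr_ge0.
have PT1 : (\int[P]_y (cst 1 y) = 1)%E.
  by rewrite integral_cst// mul1e; exact: probability_setT.
have upper m : m.+1%:R * i <= \sum_(j < m.+1) G (level u m.+1 j) + 1.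
  have Ih1 : (\int[P]_y (h m y + 1)%:E =
      (\sum_(j < m.+1) G (level u m.+1 j) + 1)%:E)%E.
    under eq_integral do rewrite EFinD.
    rewrite ge0_integralD//.
    - by rewrite Ih [X in (_ + X)%E]PT1 EFinD.
    - by move=> y _; rewrite lee_fin.
    - exact/measurable_EFinP.
  rewrite -lee_fin -Ih1.
  rewrite -If; apply: ge0_le_integral; first exact: measurableT.
  - by move=> y _; rewrite lee_fin mulr_ge0.
  - exact/measurable_EFinP.
  - by apply/measurable_EFinP; exact: measurable_funD.
  - by move=> y _; rewrite lee_fin hE sum_levels_ge// ler_piMr.
rewrite iE; congr EFin; apply/eqP; rewrite -subr_eq0 -normr_le0.
apply/ler_addgt0Pr => e e0; rewrite add0r.
pose m := Num.bound (3 / e).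
have m0 : 0 < m.+1%:R :> R by rewrite ltr0n.
have me : 3 <= m.+1%:R * e.
  rewrite -ler_pdivrMr//; apply: le_trans (ltW (archi_boundP _)) _.
    by rewrite divr_ge0// ltW.
  by rewrite ler_nat leqnSn.
rewrite -(ler_pM2l m0) -[X in X * _]gtr0_norm// -normrM mulrBr.
have := lower m; have := upper m; have := sum_level_cdf_ge m u0.
have := sum_level_cdf_le m u0.
move: (\sum_(j < m.+1) _) => s h1 h2 h3 h4.
apply: le_trans me; rewrite ler_norml; apply/andP; split; lra.
Qed.

Lemma bernstein : exists (d : measure_display) (T : measurableType d)
    (P : probability T R) (S : {RV P >-> R}),
  {ae P, forall w, 0 < S w} /\
  forall u, 0 <= u -> (\int[P]_w (expR (- (u * S w)))%:E = (phi u)%:E)%E.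
Proof.
have [P PG] := majorant_cdf_probability.
pose S (y : R) := Num.max y 0.
have mS : measurable_fun [set: measurableTypeR R] S.
  exact: (measurable_maxr (@measurable_id _ _ _) (measurable_cst _)).
pose S' : {mfun measurableTypeR R >-> R} :=
  HB.pack S (isMeasurableFun.Build _ _ _ _ _ mS).
exists _, (measurableTypeR R), P, S'; split.
  exists `]-oo, 0]%classic; split; first exact: measurable_itv.
    by rewrite PG majorant_cdf0.
  move=> y /= /negP; rewrite /S -leNgt ge_max lexx andbT.
  by rewrite in_itv.
move=> u; rewrite le_eqVlt => /predU1P[<-|]; last exact: majorant_cdf_laplace.
under eq_integral do rewrite mul0r oppr0 expR0.
by rewrite phi0 integral_cst// mul1e; exact: probability_setT.
Qed.

End bernstein.

Lemma positive_stable_exists (R : realType) (alpha : R) : 0 < alpha < 1 ->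
  exists (d : measure_display) (T : measurableType d) (P : probability T R)
    (S : {RV P >-> R}), positive_stable alpha P S.
Proof.
move=> alpha01; have [a0 _] := andP alpha01.
have root (e : R) : 0 < e -> (e `^ alpha^-1) `^ alpha = e.
  by move=> e0; rewrite -powRrM mulVf ?gt_eqF// powRr1// ltW.
have [||e e0|e e0|d [T [P [S [S0 SE]]]]] :=
  @bernstein R (fun u => expR (- (u `^ alpha))).
- exact: exp_powR_laplace_positive.
- by rewrite powR0 ?gt_eqF// oppr0 expR0.
- have h0 : 0 < e / 2 by rewrite divr_gt0.
  (* Here u^alpha = e / 2, and exp(- e / 2) >= 1 - e / 2. In the next case u^alpha = 1 / e, and
     exp(1 / e) > 1 / e. *)
  exists ((e / 2) `^ alpha^-1); first exact: powR_gt0.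
  rewrite root//; apply: lt_le_trans (expR_ge1Dx _); lra.
- have h0 : 0 < e^-1 by rewrite invr_gt0.
  exists (e^-1 `^ alpha^-1); first exact: powR_gt0.
  rewrite root// expRN -[ltRHS]invrK ltf_pV2 ?posrE ?expR_gt0//.
  by apply: lt_le_trans (expR_ge1Dx _); rewrite ltrDr.
exists d, T, P, S; split => // u u0.
by rewrite unlock SE.
Qed.

(** * Existence of the factor for p <= q *)

Section gen_normal_scale.
Variables (R : realType) (p q : R).
Hypotheses (p0 : 0 < p) (q0 : 0 < q).
Context dp (Tp : measurableType dp) (Pp : probability Tp R) (Xp : {RV Pp >-> R}).
Hypothesis Xp_law : gen_normal p Pp Xp.
Context dq (Tq : measurableType dq) (Pq : probability Tq R) (Xq : {RV Pq >-> R}).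
Hypothesis Xq_law : gen_normal q Pq Xq.

Lemma scale_factor_cst1 : p = q ->
  scale_factor Pq (fun=> 1) Xq (distribution Pp Xp).
Proof.
move=> pq; split.
- by apply: aeW => w; exact: ltr01.
- move=> A B mA mB; rewrite (_ : (fun=> 1) @^-1` A = [set w | A 1])//.
  have [A1|A1] := pselect (A 1).
    rewrite (_ : [set _ | _] = setT) ?setTI ?probability_setT ?mul1e//.
    by apply/seteqP; split.
  rewrite (_ : [set _ | _] = set0) ?set0I ?measure0 ?mul0e//.
  by apply/seteqP; split.
- move=> A mA; rewrite /pushforward; under eq_fun do rewrite mul1r.
  by rewrite [RHS](Xp_law mA) pq -(Xq_law mA).
Qed.

Section stable_factor.
Context d0 (T0 : measurableType d0) (P0 : probability T0 R) (S : {RV P0 >-> R}).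
Hypothesis stableS : positive_stable (p / q) P0 S.
Local Notation W0 := (fun w : T0 => S w `^ (- q^-1)).

Lemma stable_moment_bounds : (0 < 'E_P0[W0] < +oo)%E.
Proof.
have [Kp _] := gen_normal_mass p0 Xp_law; have [Kq _] := gen_normal_mass q0 Xq_law.
rewrite (stable_moment p0 q0 stableS Xp_law Xq_law) lte_fin ltry andbT.
by rewrite divr_gt0// mulr_gt0// powR_gt0.
Qed.

Lemma stable_size_biased_exists :
  exists (d : measure_display) (T : measurableType d) (P : probability T R)
    (X W : {RV P >-> R}),
    [/\ gen_normal q P X, size_biased P0 W0 P W & independent_RV P W X].
Proof.
have mW0 : measurable_fun [set: T0] W0.
  exact: (measurableT_comp (measurable_powR _)).
have [d [T [P [X [W [X_law W_law ind]]]]]] :=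
  size_biased_exists Xq mW0 (fun w => powR_ge0 _ _) stable_moment_bounds.
exists d, T, P, X, W; split; [move=> A mA|exact: W_law|exact: ind].
by rewrite -[RHS](Xq_law mA); exact: X_law.
Qed.

End stable_factor.

Lemma scale_factor_exists : p <= q ->
  exists (d : measure_display) (T : measurableType d) (P : probability T R)
    (X V : {RV P >-> R}),
    gen_normal q P X /\ scale_factor P V X (distribution Pp Xp).
Proof.
rewrite le_eqVlt => /predU1P[pq|pq].
  exists dq, Tq, Pq, Xq, (cst 1); split=> //; exact: scale_factor_cst1.
have alpha01 : 0 < p / q < 1 by rewrite divr_gt0// ltr_pdivrMr// mul1r.
have [d0 [T0 [P0 [S stableS]]]] := positive_stable_exists alpha01.
have [d [T [P [X [W [X_law W_law ind]]]]]] := stable_size_biased_exists stableS.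
have mV : measurable_fun [set: T] (fun w => 2 `^ (p^-1 - q^-1) * W w).
  exact: measurable_funM.
pose V : {mfun T >-> R} :=
  HB.pack (fun w => 2 `^ (p^-1 - q^-1) * W w) (isMeasurableFun.Build _ _ _ _ _ mV).
exists d, T, P, X, V; split; first by move=> A mA; exact: X_law.
exact: (size_biased_stable_scale_factor p0 q0 stableS Xp_law X_law W_law ind).
Qed.

End gen_normal_scale.

Theorem theorem1 (R : realType) (p q : R) (p_gt0 : 0 < p) (q_gt0 : 0 < q)
    (dp : measure_display) (Tp : measurableType dp) (Pp : probability Tp R)
    (Xp : {RV Pp >-> R}) (Xp_law : gen_normal p Pp Xp)
    (dq : measure_display) (Tq : measurableType dq) (Pq : probability Tq R)
    (Xq : {RV Pq >-> R}) (Xq_law : gen_normal q Pq Xq) :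
  (* the characterization, and its reformulation *)
  (sc_le (distribution Pp Xp) (distribution Pq Xq) <-> p <= q) /\
  ((exists (d : measure_display) (T : measurableType d) (P : probability T R)
      (X V : {RV P >-> R}),
      gen_normal q P X /\ scale_factor P V X (distribution Pp Xp))
    <-> p <= q) /\
  (* uniqueness of the law of V *)
  (forall (d1 : measure_display) (T1 : measurableType d1)
      (P1 : probability T1 R) (X1 V1 : {RV P1 >-> R})
      (d2 : measure_display) (T2 : measurableType d2)
      (P2 : probability T2 R) (X2 V2 : {RV P2 >-> R}),
    gen_normal q P1 X1 -> scale_factor P1 V1 X1 (distribution Pp Xp) ->
    gen_normal q P2 X2 -> scale_factor P2 V2 X2 (distribution Pp Xp) ->
    eq_law (distribution P1 V1) (distribution P2 V2)) /\
  (* (1) *)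
  (p = q -> scale_factor Pq (fun=> 1) Xq (distribution Pp Xp)) /\
  (* (2) *)
  (p < q ->
    let a := p^-1 in
    let b := q^-1 in
    let alpha := b / a in
    [/\ alpha = p / q,
        (exists (d0 : measure_display) (T0 : measurableType d0)
           (P0 : probability T0 R) (S : {RV P0 >-> R}),
           positive_stable alpha P0 S) &
        forall (d0 : measure_display) (T0 : measurableType d0)
           (P0 : probability T0 R) (S : {RV P0 >-> R}),
          positive_stable alpha P0 S ->
          let W0 := fun w : T0 => S w `^ (- b) in
          [/\ (0 < 'E_P0[W0] < +oo)%E,
              (exists (d : measure_display) (T : measurableType d)
                 (P : probability T R) (X W : {RV P >-> R}),
                 [/\ gen_normal q P X, size_biased P0 W0 P W &
                     independent_RV P W X]) &
              forall (d : measure_display) (T : measurableType d)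
                 (P : probability T R) (X W : {RV P >-> R}),
                gen_normal q P X -> size_biased P0 W0 P W ->
                independent_RV P W X ->
                scale_factor P (fun w => 2 `^ (a - b) * W w) X
                  (distribution Pp Xp)]]) /\
  (* (3) *)
  (q < p ->
    ~ exists (d : measure_display) (T : measurableType d)
        (P : probability T R) (X V : {RV P >-> R}),
        gen_normal q P X /\ scale_factor P V X (distribution Pp Xp)).
Proof.
have exist_iff : (exists (d : measure_display) (T : measurableType d)
    (P : probability T R) (X V : {RV P >-> R}),
    gen_normal q P X /\ scale_factor P V X (distribution Pp Xp)) <-> p <= q.
  split=> [[d [T [P [X [V [X_law VX]]]]]]|].
    exact: (scale_factor_exponent_le p_gt0 q_gt0 Xp_law X_law VX).
  exact: (scale_factor_exists p_gt0 q_gt0 Xp_law Xq_law).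
split.
  split=> [[d [T [P [Z [V [Z_law VZ]]]]]]|/exist_iff].
    apply/exist_iff; exists d, T, P, Z, V; split; last exact: VZ.
    by move=> A mA; rewrite -[RHS](Xq_law A mA); exact: Z_law.
  move=> [d [T [P [X [V [X_law VX]]]]]]; exists d, T, P, X, V; split; last exact: VX.
  by move=> A mA; rewrite [RHS](Xq_law A mA); exact: X_law.
split; first exact: exist_iff.
split.
  move=> d1 T1 P1 X1 V1 d2 T2 P2 X2 V2 X1_law VX1 X2_law VX2.
  exact: (scale_factor_unique p_gt0 q_gt0 Xp_law X1_law VX1 X2_law VX2).
split; first exact: (scale_factor_cst1 Xp_law Xq_law).
split; last by move=> qp /exist_iff; rewrite leNgt qp.
move=> pq a b alpha.
have alphaE : alpha = p / q by rewrite /alpha /a /b invrK mulrC.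
have alpha01 : 0 < alpha < 1.
  by rewrite alphaE divr_gt0// ltr_pdivrMr// mul1r.
split; [exact: alphaE|exact: positive_stable_exists|].
rewrite alphaE => d0 T0 P0 S stableS W0.
split.
- exact: (stable_moment_bounds p_gt0 q_gt0 Xp_law Xq_law stableS).
- exact: (stable_size_biased_exists p_gt0 q_gt0 Xp_law Xq_law stableS).
- move=> d T P X W X_law W_law ind.
  exact: (size_biased_stable_scale_factor p_gt0 q_gt0 stableS Xp_law X_law W_law ind).
Qed.
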